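(* Let $(\Lambda,\le)$ be a directed poset, let $(X,\mu)$ be a measure space of the type described in the context, and for each $p\in X$ let $\{\mathcal{H}_p;\ \mathcal{E}_p=\{\mathcal{H}_{\alpha,p}\}_{\alpha\in\Lambda};\ \mathcal{D}_p\}$ be a quantized domain. Then the algebra $C^*_{\mathcal{E},\mathrm{DIAG}}\left(\int^{\oplus_{\mathrm{loc}}}_{X_{\mathrm{loc}}}\mathcal{D}_p\,d\mu(p)\right)$ of diagonalizable locally bounded operators can be canonically embedded in $\mathcal{B}\left(\int_X^\oplus\mathcal{H}_p\,d\mu(p)\right)$ as an abelian von Neumann algebra; that is, every $T$ in this algebra extends uniquely to a bounded operator $\widetilde{T}$ on $\int_X^\oplus\mathcal{H}_p\,d\mu(p)$, and $T\mapsto\widetilde{T}$ is an injective $*$-homomorphism whose range is an abelian von Neumann algebra.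
   Context: **Measure space.** $X$ is a $\sigma$-compact locally compact space and $\mu$ is the completion of a positive Borel measure on $X$. **Strictly inductive system, locally Hilbert space, quantized domain.** Let $(\Lambda,\le)$ be a directed poset. A family $\mathcal{F}=\{\mathcal{H}_\alpha\}_{\alpha\in\Lambda}$ of Hilbert spaces is a strictly inductive system if, whenever $\alpha\le\beta$, $\mathcal{H}_\alpha\subseteq\mathcal{H}_\beta$ and the inclusion is isometric. Its inductive limit is $\mathcal{D}=\bigcup_{\alpha\in\Lambda}\mathcal{H}_\alpha$, called a locally Hilbert space. A quantized domain $\{\mathcal{H};\mathcal{F}=\{\mathcal{H}_\alpha\}_{\alpha\in\Lambda};\mathcal{D}\}$ consists of a strictly inductive system $\mathcal{F}$, the locally Hilbert space $\mathcal{D}=\bigcup_\alpha\mathcal{H}_\alpha$, and the Hilbert space $\mathcal{H}=\overline{\mathcal{D}}$ which is the completion of $\mathcal{D}$. **Locally bounded operators.** $C^*_{\mathcal{F}}(\mathcal{D})$ is the set of linear operators $T:\mathcal{D}\to\mathcal{D}$ such that for each $\alpha\in\Lambda$: $T(\mathcal{H}_\alpha)\subseteq\mathcal{H}_\alpha$, $T(\mathcal{H}_\alpha^\perp\cap\mathcal{D})\subseteq\mathcal{H}_\alpha^\perp\cap\mathcal{D}$, and $T|_{\mathcal{H}_\alpha}\in\mathcal{B}(\mathcal{H}_\alpha)$. It is a unital $*$-algebra, where $T^*$ is the restriction to $\mathcal{D}$ of the (unbounded) Hilbert space adjoint; equivalently $T^*|_{\mathcal{H}_\alpha}=(T|_{\mathcal{H}_\alpha})^*$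 for each $\alpha$. **Direct integral of Hilbert spaces.** Let $\{\mathcal{K}_p\}_{p\in X}$ be a family of separable Hilbert spaces. A separable Hilbert space $\mathcal{K}$ is the direct integral of $\{\mathcal{K}_p\}$ over $(X,\mu)$, written $\mathcal{K}=\int_X^\oplus\mathcal{K}_p\,d\mu(p)$, when to each $x\in\mathcal{K}$ there corresponds a function $p\mapsto x(p)$ on $X$ with $x(p)\in\mathcal{K}_p$ for each $p$, such that: (1) $p\mapsto\langle x(p),y(p)\rangle$ is $\mu$-integrable for all $x,y\in\mathcal{K}$ and $\langle x,y\rangle=\int_X\langle x(p),y(p)\rangle\,d\mu(p)$; (2) if $x_p\in\mathcal{K}_p$ for all $p\in X$ and $p\mapsto\langle x_p,y(p)\rangle$ is integrable for each $y\in\mathcal{K}$, then there is $x\in\mathcal{K}$ with $x(p)=x_p$ for $\mu$-a.e. $p$. **Standing setting.** All $\mathcal{H}_p$ (hence all $\mathcal{H}_{\alpha,p}$) are separable, and the direct integrals $\int_X^\oplus\mathcal{H}_{\alpha,p}\,d\mu(p)$ ($\alpha\in\Lambda$) and $\int_X^\oplus\mathcal{H}_p\,d\mu(p)$ are given. For $\alpha\le\beta$ one has $\int_X^\oplus\mathcal{H}_{\alpha,p}\,d\mu(p)\subseteq\int_X^\oplus\mathcal{H}_{\beta,p}\,d\mu(p)\subseteq\int_X^\oplus\mathcal{H}_p\,d\mu(p)$, coming from $\mathcal{H}_{\alpha,p}\subseteq\mathcal{H}_{\beta,p}\subseteq\mathcal{H}_p$ (an element keeps the same function $p\mapsto x(p)$,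 up to a.e. equality). Put $\mathcal{E}=\{\int_X^\oplus\mathcal{H}_{\alpha,p}\,d\mu(p)\}_{\alpha\in\Lambda}$, a strictly inductive system, and $$\int^{\oplus_{\mathrm{loc}}}_{X_{\mathrm{loc}}}\mathcal{D}_p\,d\mu(p):=\bigcup_{\alpha\in\Lambda}\int_X^\oplus\mathcal{H}_{\alpha,p}\,d\mu(p),$$ the direct integral of the locally Hilbert spaces $\mathcal{D}_p$. **Decomposable and diagonalizable locally bounded operators.** $T\in C^*_{\mathcal{E}}\left(\int^{\oplus_{\mathrm{loc}}}_{X_{\mathrm{loc}}}\mathcal{D}_p\,d\mu(p)\right)$ is decomposable if there is a family $\{T_p\in C^*_{\mathcal{E}_p}(\mathcal{D}_p)\}_{p\in X}$ such that for every $u\in\int^{\oplus_{\mathrm{loc}}}_{X_{\mathrm{loc}}}\mathcal{D}_p\,d\mu(p)$, $(Tu)(p)=T_pu(p)$ for a.e. $p\in X$. $T$ is diagonalizable if it is decomposable and there is a measurable function $f:X\to\mathbb{C}$ such that for every such $u$, $(Tu)(p)=f(p)u(p)$ for a.e. $p\in X$. The set of all diagonalizable operators is denoted $C^*_{\mathcal{E},\mathrm{DIAG}}\left(\int^{\oplus_{\mathrm{loc}}}_{X_{\mathrm{loc}}}\mathcal{D}_p\,d\mu(p)\right)$; it is a $*$-subalgebra of $C^*_{\mathcal{E}}\left(\int^{\oplus_{\mathrm{loc}}}_{X_{\mathrm{loc}}}\mathcal{D}_p\,d\mu(p)\right)$.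
   Formalization: Added: for some α, for a.e. p, H_{α,p}=0 only if H_p=0 (else unbounded diagonalizable T exist). Unique bounded extension is claimed only when the union D of the ∫H_{α,p} is dense or Λ has a cofinal sequence; otherwise it is unique among multiplication operators. *)

(* Defs.v *)
From HB Require Import structures.
From mathcomp Require Import all_boot all_order all_algebra.
From mathcomp Require Import all_classical all_reals all_analysis.
From mathcomp Require Import complex.

Set Implicit Arguments.
Unset Strict Implicit.
Unset Printing Implicit Defensive.

Import Order.TTheory GRing.Theory Num.Theory.
Import numFieldNormedType.Exports.

Local Open Scope classical_set_scope.
Local Open Scope ring_scope.

(* The inner product is linear in its first argument and conjugate-linear in
   the second one. *)
HB.mixin Record isHilbert (R : realType) V of CompleteNormedModule R[i] V := {
  hdot : {dot V for (@Num.conj R[i])} ;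
  normr_hdot : forall x : V, `|x| ^+ 2 = hdot x x
}.

#[short(type="hilbertType")]
HB.structure Definition Hilbert (R : realType) :=
  {V of isHilbert R V & CompleteNormedModule R[i] V}.

Section HilbertSpaces.
Variables (R : realType) (V : hilbertType R).
Implicit Types (D E : set V) (S T : V -> V).

(* A Hilbert space contained isometrically in V is a closed linear subspace. *)
Definition hilbert_subspace E :=
  [/\ E 0, (forall (a : R[i]) x y, E x -> E y -> E (a *: x + y)) & closed E].

Definition separable_set E :=
  exists2 D : set V, countable D & D `<=` E /\ E `<=` closure D.

Definition orthocompl E : set V := [set x | forall y, E y -> hdot x y = 0].

Definition linear_on D T :=
  forall (a : R[i]) x y, D x -> D y -> T (a *: x + y) = a *: T x + T y.

Definition bounded_on D T :=
  exists M : R[i], forall x, D x -> `|T x| <= M * `|x|.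

Definition bounded_operator : set (V -> V) :=
  [set T | linear_on setT T /\ bounded_on setT T].

Definition adjoint_on D T S :=
  forall x y, D x -> D y -> hdot (T x) y = hdot x (S y).

Definition extends D T S := forall x, D x -> S x = T x.

Definition star_subalgebra D (A : set (V -> V)) :=
  [/\ A (fun=> 0),
      forall (a : R[i]) S T, A S -> A T -> A (fun x => a *: S x + T x),
      forall S T, A S -> A T -> A (S \o T)
    & forall T, A T -> exists2 S, A S & adjoint_on D T S].

Definition wot_adherent (A : set (V -> V)) S :=
  forall (s : seq (V * V)) (e : R[i]), 0 < e ->
    exists2 T, A T &
      forall u, u \in s -> `|hdot (S u.1) u.2 - hdot (T u.1) u.2| < e.

Definition von_neumann_algebra (A : set (V -> V)) :=
  [/\ A `<=` bounded_operator, star_subalgebra setT A, A id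
    & forall S, bounded_operator S -> wot_adherent A S -> A S].

Definition abelian_algebra (A : set (V -> V)) :=
  forall S T, A S -> A T -> S \o T = T \o S.

End HilbertSpaces.

(* For operator algebras A on D (a subspace of V) and the image on V. *)
Definition star_homomorphism (R : realType) (V : hilbertType R) (D : set V)
    (A : set (V -> V)) (Phi : (V -> V) -> V -> V) :=
  [/\ forall (a : R[i]) S T, A S -> A T ->
        Phi (fun x => a *: S x + T x) = (fun x => a *: Phi S x + Phi T x),
      forall S T, A S -> A T -> Phi (S \o T) = Phi S \o Phi T
    & forall S T, A S -> A T -> adjoint_on D T S ->
        adjoint_on setT (Phi T) (Phi S)].

Section QuantizedDomains.
Variables (R : realType) (d : Order.disp_t) (L : porderType d).

Definition directed :=
  [set: L] !=set0 /\ forall a b : L, exists c, (a <= c)%O /\ (b <= c)%O.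

Definition countably_cofinal :=
  exists s : nat -> L, forall a, exists n, (a <= s n)%O.

Variable V : hilbertType R.
Implicit Type E : L -> set V.

Definition strictly_inductive E :=
  (forall a, hilbert_subspace (E a)) /\
  (forall a b, (a <= b)%O -> E a `<=` E b).

Definition locally_hilbert E : set V := \bigcup_a E a.

Definition quantized_domain E :=
  strictly_inductive E /\ closure (locally_hilbert E) = setT.

(* An operator on the locally Hilbert space D is represented by a total
   function that is 0 outside D, so that equality of functions is equality of
   operators on D, and pointwise operations and composition are those of
   operators on D. *)
Definition locally_bounded E : set (V -> V) :=
  [set T | [/\ forall x, ~ locally_hilbert E x -> T x = 0,
               linear_on (locally_hilbert E) T
             & forall a, [/\ forall x, E a x -> E a (T x),
                   forall x, locally_hilbert E x -> orthocompl (E a) x ->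
                     orthocompl (E a) (T x)
                 & bounded_on (E a) T]]].

End QuantizedDomains.

#[short(type="topMeasurableType")]
HB.structure Definition TopMeasurable d := {X of Topological X & Measurable d X}.

Section DirectIntegrals.
Variables (R : realType) (d : measure_display) (X : topMeasurableType d).

Definition sigma_compact :=
  exists2 C : nat -> set X, forall n, compact (C n) & \bigcup_n C n = setT.

Variable mu : {measure set X -> \bar R}.

Let borel : set (set X) := <<s @open X >>.

(* The sigma-algebra of X is the completion of the Borel sigma-algebra with
   respect to (the restriction to Borel sets of) mu. *)
Definition completed_borel_measure :=
  (measurable : set (set X)) =
  [set A | exists B N, [/\ borel B, borel N, mu N = 0%E &
                           (A `\` B) `|` (B `\` A) `<=` N]].

Definition cmeasurable (f : X -> R[i]) :=
  measurable_fun setT (fun p => complex.Re (f p)) /\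
  measurable_fun setT (fun p => complex.Im (f p)).

Definition cintegrable (f : X -> R[i]) :=
  mu.-integrable setT (fun p => (complex.Re (f p))%:E) /\
  mu.-integrable setT (fun p => (complex.Im (f p))%:E).

Definition cintegral (f : X -> R[i]) : R[i] :=
  Complex (\int[mu]_p complex.Re (f p)) (\int[mu]_p complex.Im (f p)).

Variables (H : X -> hilbertType R) (K : hilbertType R).

(* K0 (a Hilbert subspace of K) is the direct integral of the Hilbert
   subspaces F p of H p, the function attached to x in K0 being
   p |-> sec x p.  The values of sec outside K0 are irrelevant. *)
Definition direct_integral (F : forall p, set (H p)) (K0 : set K)
    (sec : K -> forall p, H p) :=
  [/\ hilbert_subspace K0 /\ separable_set K0,
      forall x p, K0 x -> F p (sec x p),
      forall x y, K0 x -> K0 y ->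
        cintegrable (fun p => hdot (sec x p) (sec y p)) /\
        hdot x y = cintegral (fun p => hdot (sec x p) (sec y p))
    & forall v : forall p, H p, (forall p, F p (v p)) ->
        (forall y, K0 y -> cintegrable (fun p => hdot (v p) (sec y p))) ->
        exists2 x, K0 x & {ae mu, forall p, sec x p = v p}].

Variables (dL : Order.disp_t) (L : porderType dL).
Variables (E : L -> forall p, set (H p)) (KE : L -> set K).
Variable sec : K -> forall p, H p.
Arguments E : clear implicits.

Definition decomposable_op : set (K -> K) :=
  [set T | locally_bounded KE T /\
     exists2 Tp : forall p, H p -> H p, 
         forall p, locally_bounded (fun a => E a p) (Tp p) &
       forall u, locally_hilbert KE u ->
         {ae mu, forall p, sec (T u) p = Tp p (sec u p)}].

Definition multiplication_on (D : set K) (T : K -> K) :=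
  exists2 f : X -> R[i], cmeasurable f &
    forall u, D u -> {ae mu, forall p, sec (T u) p = f p *: sec u p}.

Definition diagonalizable_op : set (K -> K) :=
  [set T | decomposable_op T /\ multiplication_on (locally_hilbert KE) T].

End DirectIntegrals.

(* Main.v *)
Require Import Defs.
From HB Require Import structures.
From mathcomp Require Import all_boot all_order all_algebra.
From mathcomp Require Import all_classical all_reals all_analysis.
From mathcomp Require Import complex measurable_realfun ring lra.

Set Implicit Arguments.
Unset Strict Implicit.
Unset Printing Implicit Defensive.

Import Order.TTheory GRing.Theory Num.Theory.
Import numFieldNormedType.Exports.

Local Open Scope classical_set_scope.
Local Open Scope ring_scope.

(* With q(v) = |v|^2: a diagonalizable T, with symbol f, satisfies |f| <= M a.e.
   on the set where H_(a,p) <> 0, because T is bounded by M on KE a and KE a is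
   stable under multiplication by indicator functions; for the index a of the
   support hypothesis this is a.e. the set where H_p <> 0, so f multiplies the
   whole of K, and multiplication by f on K is the extension of T.  Conversely
   a bounded multiplication operator on K preserves every KE a (its symbol acts
   fiberwise, and the axioms of direct integrals put the result back in KE a),
   so it restricts to a diagonalizable operator.  Hence T |-> its extension is a
   bijection onto the bounded multiplication operators on K, and everything
   reduces to the weak closedness of the latter.  If S is weakly adherent to
   them, <S x, y> only depends on the function p |-> <x(p), y(p)>, which forces
   q(xi(p)) <(S x)(p), y(p)> = <(S xi)(p), xi(p)> <x(p), y(p)> a.e. for every
   xi; taking for xi the first nonvanishing member of a dense sequence gives a
   symbol for S. *)

(** * Real and imaginary parts and the squared modulus *)

Section ComplexParts.
Variable R : rcfType.
Implicit Types a b : R[i].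

Lemma ReD a b : complex.Re (a + b) = complex.Re a + complex.Re b.
Proof. by case: a b => ? ? []. Qed.

Lemma ImD a b : complex.Im (a + b) = complex.Im a + complex.Im b.
Proof. by case: a b => ? ? []. Qed.

Lemma ReB a b : complex.Re (a - b) = complex.Re a - complex.Re b.
Proof. by case: a b => ? ? []. Qed.

Lemma ReM a b : complex.Re (a * b) =
  complex.Re a * complex.Re b - complex.Im a * complex.Im b.
Proof. by case: a b => ? ? []. Qed.

Lemma ImM a b : complex.Im (a * b) =
  complex.Re a * complex.Im b + complex.Im a * complex.Re b.
Proof. by case: a b => ? ? [] * /=; rewrite addrC. Qed.

Lemma ReJ a : complex.Re a^* = complex.Re a.
Proof. by case: a. Qed.

Lemma ImJ a : complex.Im a^* = - complex.Im a.
Proof. by case: a. Qed.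

Definition sqmod a : R := complex.Re a ^+ 2 + complex.Im a ^+ 2.

Lemma sqmod_ge0 a : 0 <= sqmod a.
Proof. by rewrite addr_ge0 ?sqr_ge0. Qed.

Lemma sqmodM a b : sqmod (a * b) = sqmod a * sqmod b.
Proof. by rewrite /sqmod ReM ImM; ring. Qed.

Lemma sqmodJ a : sqmod a^* = sqmod a.
Proof. by rewrite /sqmod ReJ ImJ sqrrN. Qed.

Lemma sqmodE a : a * a^* = (sqmod a)%:C%C.
Proof.
by apply/eqP; rewrite eq_complex ReM ImM ReJ ImJ /sqmod /=; apply/andP; split;
  apply/eqP; ring.
Qed.

Lemma sqmod_eq0 a : (sqmod a == 0) = (a == 0).
Proof. by rewrite paddr_eq0 ?sqr_ge0// !sqrf_eq0 eq_complex. Qed.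

End ComplexParts.

(** * Inner products and squared norms in a Hilbert space *)

Section InnerProduct.
Variables (R : realType) (V : hilbertType R).
Implicit Types (x y z : V) (a : R[i]).

Lemma hdotC x y : hdot x y = (hdot y x)^*.
Proof. by rewrite hermC expr0 mul1r. Qed.

Lemma hdotDl x y z : hdot (x + y) z = hdot x z + hdot y z.
Proof. exact: linearDl. Qed.

Lemma hdotDr x y z : hdot z (x + y) = hdot z x + hdot z y.
Proof. by rewrite hdotC hdotDl rmorphD (hdotC z x) (hdotC z y). Qed.

Lemma hdotZl a x y : hdot (a *: x) y = a * hdot x y.
Proof. exact: linearZl_LR. Qed.

Lemma hdotZr a x y : hdot x (a *: y) = a^* * hdot x y.
Proof. by rewrite hdotC hdotZl rmorphM (hdotC x y). Qed.

Lemma hdot0l x : hdot 0 x = 0.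
Proof. exact: linear0l. Qed.

Lemma hdot0r x : hdot x 0 = 0.
Proof. by rewrite hdotC hdot0l rmorph0. Qed.

Lemma hdotNl x y : hdot (- x) y = - hdot x y.
Proof. exact: linearNl. Qed.

Lemma hdotBl x y z : hdot (x - y) z = hdot x z - hdot y z.
Proof. exact: linearBl. Qed.

Lemma hdotBr x y z : hdot z (x - y) = hdot z x - hdot z y.
Proof. by rewrite hdotC hdotBl rmorphB (hdotC z x) (hdotC z y). Qed.

(** Real-valued, so that order and integration arguments stay in [R]; the norm of [V] takes its
    values in [R[i]]. *)
Definition sqnorm x : R := complex.Re (hdot x x).

Lemma hdotxx x : hdot x x = (sqnorm x)%:C%C.
Proof.
have := dnorm_ge0 (@hdot R V) x; rewrite /sqnorm.
by case: (hdot x x) => a b; rewrite lecE /= => /andP[/eqP ->].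
Qed.

Lemma sqnorm_ge0 x : 0 <= sqnorm x.
Proof. by have := dnorm_ge0 (@hdot R V) x; rewrite hdotxx ler0c. Qed.

Lemma sqnorm_eq0 x : (sqnorm x == 0) = (x == 0).
Proof. by rewrite -(dnorm_eq0 (@hdot R V)) hdotxx eq_complex /= eqxx andbT. Qed.

Lemma sqnorm0 : sqnorm 0 = 0.
Proof. by apply/eqP; rewrite sqnorm_eq0. Qed.

Lemma sqnormZ a x : sqnorm (a *: x) = sqmod a * sqnorm x.
Proof. by rewrite /sqnorm hdotZl hdotZr mulrA sqmodE hdotxx ReM /= mul0r subr0. Qed.

Lemma sqnormD x y :
  sqnorm (x + y) = sqnorm x + sqnorm y + 2 * complex.Re (hdot x y).
Proof.
rewrite /sqnorm hdotDl !hdotDr !ReD [hdot y x]hdotC ReJ; ring.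
Qed.

Lemma sqnormN x : sqnorm (- x) = sqnorm x.
Proof. by rewrite /sqnorm hdotNl hdotC hdotNl rmorphN opprK ReJ. Qed.

Lemma sqnormB x y :
  sqnorm (x - y) = sqnorm x + sqnorm y - 2 * complex.Re (hdot x y).
Proof.
rewrite /sqnorm hdotBl !hdotBr !ReB [hdot y x]hdotC ReJ; ring.
Qed.

Lemma Re_hdot_le x y : `|complex.Re (hdot x y)| <= (sqnorm x + sqnorm y) / 2.
Proof.
rewrite ler_norml; have := sqnorm_ge0 (x + y); have := sqnorm_ge0 (x - y).
by rewrite sqnormB sqnormD => *; apply/andP; split; lra.
Qed.

Lemma Im_hdot_le x y : `|complex.Im (hdot x y)| <= (sqnorm x + sqnorm y) / 2.
Proof.
(* Multiplying [x] by i keeps its norm and turns the imaginary part into minus a real part. *)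
have := Re_hdot_le ('i%C *: x) y; rewrite hdotZl sqnormZ ReM /sqmod /=.
by rewrite mul0r sub0r mul1r normrN expr0n add0r expr1n mul1r.
Qed.

Lemma normE x : `|x| = (Num.sqrt (sqnorm x))%:C%C.
Proof.
apply/eqP; rewrite -(@eqrXn2 _ 2) ?normr_ge0// ?ler0c ?sqrtr_ge0//.
by rewrite normr_hdot hdotxx -rmorphXn /= sqr_sqrtr// sqnorm_ge0.
Qed.

Lemma norm_lt_sqnorm x (e : R) : 0 < e -> (`|x| < e%:C%C) = (sqnorm x < e ^+ 2).
Proof.
move=> e0; rewrite normE ltcR -[in RHS](@ltr_sqrt _ (sqnorm x)) ?exprn_gt0//.
by rewrite sqrtr_sqr gtr0_norm.
Qed.

Lemma closure_sqnormP (A : set V) x :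
  closure A x <-> forall e : R, 0 < e -> exists2 y, A y & sqnorm (x - y) < e.
Proof.
split=> [cA e e0|H B /nbhs_ballP[[e e'] e0 xB]].
- have e0' : 0 < (Num.sqrt e)%:C%C :> R[i] by rewrite ltcR sqrtr_gt0.
  have [y [Ay]] := cA _ (nbhsx_ballx x _ e0').
  rewrite -ball_normE /ball_ /= norm_lt_sqnorm ?sqrtr_gt0// sqr_sqrtr ?ltW//.
  by exists y.
(* A positive element of [R[i]] has zero imaginary part, so the radius is real. *)
- move: e0; rewrite /= ltcE /= => /andP[/eqP e'0 e0]; rewrite {}e'0 in xB.
  have [y Ay xy] := H _ (exprn_gt0 2 e0); exists y; split => //; apply: xB.
  by rewrite -ball_normE /ball_ /= norm_lt_sqnorm.
Qed.

Lemma bounded_on_sqnormP (D : set V) (T : V -> V) : bounded_on D T <->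
  exists2 c : R, 0 <= c & forall x, D x -> sqnorm (T x) <= c * sqnorm x.
Proof.
split=> [[[M M'] TM]|[c c0 Tc]].
(* Only the real part [M] of the bound matters in the order of [R[i]]; squaring it gives a
   nonnegative constant whatever its sign. *)
- exists (M ^+ 2); first exact: sqr_ge0.
  move=> x Dx; have := TM _ Dx; rewrite !normE lecE ReM /=.
  move=> /andP[_]; rewrite mulr0 subr0.
  rewrite -(@ler_sqrt _ (sqnorm (T x))); last first.
    by rewrite mulr_ge0 ?sqr_ge0 ?sqnorm_ge0.
  move/le_trans; apply; rewrite sqrtrM ?sqr_ge0// sqrtr_sqr.
  by rewrite ler_wpM2r ?sqrtr_ge0 ?ler_norm.
- exists (Num.sqrt c)%:C%C => x Dx; rewrite !normE -rmorphM lecR.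
  by rewrite -sqrtrM// ler_sqrt ?Tc// mulr_ge0// sqnorm_ge0.
Qed.

Lemma sqnorm_cauchy_cvg (u : nat -> V) :
  (forall e : R, 0 < e ->
     exists N, forall m n, (N <= m)%N -> (N <= n)%N -> sqnorm (u m - u n) < e) ->
  exists l, forall e : R, 0 < e ->
     exists N, forall n, (N <= n)%N -> sqnorm (l - u n) < e.
Proof.
move=> cu.
have : cauchy (u @ \oo).
  apply/cauchy_ballP => -[e e']; rewrite ltcE /= => /andP[/eqP -> e0].
  have [N HN] := cu _ (exprn_gt0 2 e0).
  exists ([set y | exists2 n, (N <= n)%N & y = u n],
          [set y | exists2 n, (N <= n)%N & y = u n]) => /=.
    by split; exists N => // n Nn; exists n.
  move=> [y z] /= [[n Nn ->] [m Nm ->]].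
  by rewrite -ball_normE /ball_ /= norm_lt_sqnorm// HN.
move=> /cauchy_cvgP/cvg_ex[l /cvgrPdist_lt ul]; exists l => e e0.
have e0' : 0 < (Num.sqrt e)%:C%C :> R[i] by rewrite ltcR sqrtr_gt0.
have [N _ HN] := ul _ e0'.
exists N => n Nn; have := HN n Nn.
by rewrite /= norm_lt_sqnorm ?sqrtr_gt0// sqr_sqrtr// ltW.
Qed.

End InnerProduct.

(** * Complex measurable and integrable functions, and a.e. equality *)

Section Measurable.
Variables (R : realType) (d : measure_display) (X : topMeasurableType d).
Variable mu : {measure set X -> \bar R}.

(** A null set [N] is a Borel set [B] up to a Borel null set [N'], so a subset of [N] lies in the
    union of [B] and [N']. This union is Borel and null, and the subset differs from the empty set
    only inside it. *)
Lemma completed_borel_measure_complete :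
  completed_borel_measure mu -> measure_is_complete mu.
Proof.
move=> cmu A [N [mN N0 AN]].
have := mN; rewrite cmu => -[B [N' [bB bN' N'0 BN']]].
exists set0, (B `|` N'); split; first exact: sigma_algebra0.
- exact: (@measurableU _ (g_sigma_algebraType (@open X))).
- have bsub C : <<s @open X >> C -> measurable C.
    move=> bC; rewrite cmu; exists C, set0; split=> //.
      exact: sigma_algebra0.
    by rewrite !setDv setU0.
  have mB := bsub _ bB; have mN' := bsub _ bN'.
  apply/eqP; rewrite -measure_le0.
  apply: (@le_trans _ _ (mu (N `|` N'))).
    apply: le_measure; rewrite ?inE; [exact: measurableU..|].
    move=> p [Bp|]; last by right.
    have [Np|Np] := pselect (N p); first by left.
    by right; apply: BN'; right.
  rewrite (le_trans (measureU2 _ mN mN'))//.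
  rewrite [X in (_ + X)%E]N'0 adde0 le_eqVlt; apply/orP; left; apply/eqP.
  exact: N0.
- rewrite set0D setD0 => p [Ap|//].
  have [Bp|Bp] := pselect (B p); first by left.
  by right; apply: BN'; left; split => //; exact: AN.
Qed.

Implicit Types f g : X -> R[i].

Lemma cmeasurableD f g : cmeasurable f -> cmeasurable g ->
  cmeasurable (fun p => f p + g p).
Proof.
move=> [rf jf] [rg jg]; split.
  by under eq_fun do rewrite ReD; exact: measurable_funD.
by under eq_fun do rewrite ImD; exact: measurable_funD.
Qed.

Lemma cmeasurableM f g : cmeasurable f -> cmeasurable g ->
  cmeasurable (fun p => f p * g p).
Proof.
move=> [rf jf] [rg jg]; split.
  under eq_fun do rewrite ReM.
  by apply: measurable_funB; exact: measurable_funM.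
under eq_fun do rewrite ImM.
by apply: measurable_funD; exact: measurable_funM.
Qed.

Lemma cmeasurableJ f : cmeasurable f -> cmeasurable (fun p => (f p)^*).
Proof.
move=> [rf jf]; split; first by under eq_fun do rewrite ReJ.
by under eq_fun do rewrite ImJ; apply: measurableT_comp.
Qed.

Lemma cmeasurable_cst (a : R[i]) : cmeasurable (fun _ : X => a).
Proof. by split; exact: measurable_cst. Qed.

Lemma cmeasurable_real (f : X -> R) : measurable_fun setT f ->
  cmeasurable (fun p => (f p)%:C%C).
Proof. by move=> mf; split => //=; exact: measurable_cst. Qed.

Lemma measurable_sqmod f : cmeasurable f ->
  measurable_fun setT (fun p => sqmod (f p)).
Proof.
by move=> [rf jf]; apply: measurable_funD; exact: measurable_funX.
Qed.

Lemma measurable_inv (f : X -> R) : (forall p, 0 <= f p) ->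
  measurable_fun setT f -> measurable_fun setT (fun p => (f p)^-1).
Proof.
(* On nonnegative reals, 0 included, inversion is the power of exponent -1. *)
move=> f0 mf; under eq_fun do rewrite -powR_inv1//.
by apply: (measurableT_comp (measurable_powR _)).
Qed.

Lemma cmeasurable_if (b : X -> bool) f g : measurable_fun setT b ->
  cmeasurable f -> cmeasurable g ->
  cmeasurable (fun p => if b p then f p else g p).
Proof.
move=> mb [rf jf] [rg jg]; split.
  under eq_fun do rewrite (fun_if (@complex.Re R)).
  exact: measurable_fun_ifT.
under eq_fun do rewrite (fun_if (@complex.Im R)).
exact: measurable_fun_ifT.
Qed.

(** Glues countably many local symbols into one global symbol. *)
Lemma measurable_fun_select d' (Y : measurableType d') (N : X -> nat)
    (g : nat -> X -> Y) : (forall n, measurable (N @^-1` [set n])) ->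
  (forall n, measurable_fun setT (g n)) ->
  measurable_fun setT (fun p => g (N p) p).
Proof.
move=> mN mg _ B mB; rewrite setTI.
have -> : (fun p => g (N p) p) @^-1` B =
    \bigcup_n (N @^-1` [set n] `&` g n @^-1` B).
  by apply/seteqP; split=> [p Bp|p [n _ [/= -> //]]]; exists (N p).
apply: bigcupT_measurable => n; apply: measurableI => //.
by rewrite -[_ @^-1` _]setTI; exact: mg.
Qed.

Lemma cintegrable_cmeasurable f : cintegrable mu f -> cmeasurable f.
Proof.
by move=> [/integrableP[/measurable_EFinP ? _] /integrableP[/measurable_EFinP]].
Qed.

Lemma cintegrable_le f (h : X -> R) : cmeasurable f ->
  mu.-integrable setT (EFin \o h) ->
  (forall p, `|complex.Re (f p)| <= h p) ->
  (forall p, `|complex.Im (f p)| <= h p) -> cintegrable mu f.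
Proof.
move=> [rf jf] ih rfh jfh; split.
  apply: le_integrable ih => //; first exact/measurable_EFinP.
  by move=> p _; rewrite /= lee_fin (le_trans (rfh p))// ler_norm.
apply: le_integrable ih => //; first exact/measurable_EFinP.
by move=> p _; rewrite /= lee_fin (le_trans (jfh p))// ler_norm.
Qed.

Lemma cintegrable0 : cintegrable mu (fun=> 0).
Proof. by split; exact: integrable0. Qed.

Lemma cintegrableD f g : cintegrable mu f -> cintegrable mu g ->
  cintegrable mu (fun p => f p + g p).
Proof.
move=> [rf jf] [rg jg]; split.
  under eq_fun do rewrite ReD EFinD; exact: integrableD.
under eq_fun do rewrite ImD EFinD; exact: integrableD.
Qed.

Lemma cintegrableZ a f : cintegrable mu f -> cintegrable mu (fun p => a * f p).
Proof.
move=> [rf jf]; split.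
  under eq_fun do rewrite ReM EFinB !EFinM.
  by apply: integrableB => //; exact: integrableZl.
under eq_fun do rewrite ImM EFinD !EFinM.
by apply: integrableD => //; exact: integrableZl.
Qed.

Lemma cintegralD f g : cintegrable mu f -> cintegrable mu g ->
  cintegral mu (fun p => f p + g p) = cintegral mu f + cintegral mu g.
Proof.
move=> [rf jf] [rg jg]; apply/eqP; rewrite eq_complex /=.
under eq_Rintegral do rewrite ReD.
under [in X in _ && X]eq_Rintegral do rewrite ImD.
by rewrite !RintegralD// !eqxx.
Qed.

Let integrableZ_EFin (r : R) (h : X -> R) : mu.-integrable setT (EFin \o h) ->
  mu.-integrable setT (EFin \o (fun p => r * h p)).
Proof. exact: (@integrableZl _ _ _ mu setT measurableT r (EFin \o h)). Qed.

Lemma cintegralZ a f : cintegrable mu f ->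
  cintegral mu (fun p => a * f p) = a * cintegral mu f.
Proof.
move=> [rf jf]; apply/eqP; rewrite eq_complex ReM ImM /=.
under eq_Rintegral do rewrite ReM.
under [in X in _ && X]eq_Rintegral do rewrite ImM.
rewrite RintegralB//; do ?exact: integrableZ_EFin.
rewrite RintegralD//; do ?exact: integrableZ_EFin.
by rewrite !RintegralZl// !eqxx.
Qed.

Hypothesis cmu : measure_is_complete mu.

(** Sections are known only up to null sets; completeness of [mu] makes [g] measurable although it
    is only a.e. equal to [f]. *)
Lemma integrable_ae_eq (f g : X -> \bar R) : ae_eq mu setT f g ->
  mu.-integrable setT f -> mu.-integrable setT g.
Proof.
move=> fg /integrableP[mf fi].
have mg := ae_measurable_fun cmu fg mf.
apply/integrableP; split => //; apply: le_lt_trans fi.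
rewrite le_eqVlt; apply/orP; left; apply/eqP.
apply: ae_eq_integral => //; do ?exact: measurableT_comp.
exact/ae_eq_abse/ae_eq_sym.
Qed.

Lemma cintegrable_ae f g : {ae mu, forall p, f p = g p} ->
  cintegrable mu f -> cintegrable mu g.
Proof.
move=> fg [rf jf]; split.
  by apply: integrable_ae_eq rf; apply: filterS fg => p /= ->.
by apply: integrable_ae_eq jf; apply: filterS fg => p /= ->.
Qed.

Lemma cintegral_ae f g : {ae mu, forall p, f p = g p} ->
  cintegrable mu f -> cintegral mu f = cintegral mu g.
Proof.
move=> fg [rf jf]; have [rg jg] := cintegrable_ae fg (conj rf jf).
rewrite /cintegral; congr Complex.
  congr fine; apply: ae_eq_integral => //.
  - exact: measurable_int rf.
  - exact: measurable_int rg.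
  - by apply: filterS fg => p /= ->.
congr fine; apply: ae_eq_integral => //.
- exact: measurable_int jf.
- exact: measurable_int jg.
- by apply: filterS fg => p /= ->.
Qed.

Lemma cintegral_ae0 f : {ae mu, forall p, f p = 0} -> cintegral mu f = 0.
Proof.
move=> f0; rewrite -(@cintegral_ae (fun=> 0)); last exact: cintegrable0.
  have := cintegralZ 0 cintegrable0.
  by under eq_fun do rewrite mulr0; rewrite mul0r.
by apply: filterS f0 => p ->.
Qed.

Lemma Rintegral_ge0_eq0 (f : X -> R) : mu.-integrable setT (EFin \o f) ->
  {ae mu, forall p, 0 <= f p} -> \int[mu]_p f p <= 0 ->
  {ae mu, forall p, f p = 0}.
Proof.
move=> fi f0 If; have mf := measurable_int _ fi.
have : (\int[mu]_p `|(f p)%:E| = 0)%E.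
  transitivity (\int[mu]_p (f p)%:E)%E.
    apply: ae_eq_integral => //; first exact: measurableT_comp.
    by apply: filterS f0 => p /= fp _; rewrite ger0_norm.
  apply/eqP; rewrite eq_le; apply/andP; split.
    by rewrite -[leLHS]fineK ?integrable_fin_num// lee_fin; exact: If.
  rewrite (_ : (\int[mu]_p (f p)%:E)%E = (\int[mu]_p `|(f p)%:E|)%E).
    exact: integral_ge0.
  apply: ae_eq_integral => //; first exact: measurableT_comp.
  by apply: filterS f0 => p /= fp _; rewrite ger0_norm.
move=> /(ae_eq_integral_abs mu measurableT mf); apply: filterS => p /=.
by move=> /(_ I)[].
Qed.

(* Testing against [conj h / (1 + |h|^2)], which is bounded. *)
Lemma cintegral_test_eq0 (h : X -> R[i]) : cintegrable mu h ->
  (forall psi, cmeasurable psi -> (forall p, sqmod (psi p) <= 1) ->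
    cintegral mu (fun p => psi p * h p) = 0) -> {ae mu, forall p, h p = 0}.
Proof.
move=> hi H; have mh := cintegrable_cmeasurable hi.
pose psi p := ((1 + sqmod (h p))^-1)%:C%C * (h p)^*.
have d0 p : 0 < 1 + sqmod (h p) by rewrite ltr_pwDl// sqmod_ge0.
have mpsi : cmeasurable psi.
  apply: cmeasurableM; last exact: cmeasurableJ.
  apply: cmeasurable_real; apply: measurable_inv => [p|]; first exact: ltW.
  by apply: measurable_funD => //; exact: measurable_sqmod.
have psih p : psi p * h p = (sqmod (h p) / (1 + sqmod (h p)))%:C%C.
  rewrite /psi -mulrA [_^* * _]mulrC sqmodE -rmorphM /=.
  by rewrite mulrC.
have psi1 p : sqmod (psi p) <= 1.
  rewrite /psi sqmodM sqmodJ /sqmod /= expr0n addr0 -/(sqmod _) exprVn.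
  rewrite mulrC ler_pdivrMr ?exprn_gt0// mul1r.
  by have := sqmod_ge0 (h p); nra.
have := H _ mpsi psi1.
under eq_fun do rewrite psih.
move=> [I0 _].
have : {ae mu, forall p, sqmod (h p) / (1 + sqmod (h p)) = 0}.
  apply: Rintegral_ge0_eq0; last by rewrite I0.
    (* The quotient is dominated by u + v, where u and v are the absolute values of the two parts of
       [h p]: one needs u^2 + v^2 <= (u + v) (1 + u^2 + v^2), and 2 u^2 <= u + u^3 because u (u -
       1)^2 >= 0, likewise for v. *)
    have [rh jh] := hi.
    have := integrableD measurableT (integrable_abse rh) (integrable_abse jh).
    apply: le_integrable => //.
      apply/measurable_EFinP; apply: measurable_funM.
        exact: measurable_sqmod.
      apply: measurable_inv => [p|]; first exact: ltW.
      by apply: measurable_funD => //; exact: measurable_sqmod.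
    move=> p _; rewrite /= lee_fin ger0_norm; last first.
      by rewrite divr_ge0 ?sqmod_ge0// ltW.
    rewrite ger0_norm ?addr_ge0 ?normr_ge0// ler_pdivrMr// /sqmod.
    rewrite -(real_normK (num_real (complex.Re _))).
    rewrite -(real_normK (num_real (complex.Im _))).
    have := normr_ge0 (complex.Re (h p)); have := normr_ge0 (complex.Im (h p)).
    set u := `|_|; set v := `|_| => u0 v0.
    have : 0 <= u * v by exact: mulr_ge0.
    have : 0 <= u * (v - 2^-1) ^+ 2 by rewrite mulr_ge0 ?sqr_ge0.
    have : 0 <= u * (u - 1) ^+ 2 by rewrite mulr_ge0 ?sqr_ge0.
    have : 0 <= v * (v - 1) ^+ 2 by rewrite mulr_ge0 ?sqr_ge0.
    have : 0 <= v * u^+2 by rewrite mulr_ge0 ?sqr_ge0.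
    have : 0 <= u * v^+2 by rewrite mulr_ge0 ?sqr_ge0.
    nra.
  by apply/aeW => p; rewrite divr_ge0 ?sqmod_ge0// ltW.
apply: filterS => p /eqP; rewrite mulf_eq0 invr_eq0 (gt_eqF (d0 p)) orbF.
by rewrite sqmod_eq0 => /eqP.
Qed.

End Measurable.

(** * Consequences of the axioms of a direct integral *)

Section DirectIntegral.
Variables (R : realType) (d : measure_display) (X : topMeasurableType d).
Variable mu : {measure set X -> \bar R}.
Hypothesis cmu : measure_is_complete mu.
Variables (H : X -> hilbertType R) (K : hilbertType R).
Variables (F : forall p, set (H p)) (K0 : set K) (sec : K -> forall p, H p).
Arguments F : clear implicits.
Hypothesis hF : forall p, hilbert_subspace (F p).
Hypothesis di : direct_integral mu F K0 sec.

Lemma di_lin a x y : K0 x -> K0 y -> K0 (a *: x + y).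
Proof. by case: di => -[[_ + _] _] _ _ _; apply. Qed.

Lemma di0 : K0 0.
Proof. by case: di => -[[]]. Qed.

Lemma di_sub x y : K0 x -> K0 y -> K0 (x - y).
Proof. by move=> Kx Ky; rewrite -scaleN1r addrC; exact: di_lin. Qed.

Lemma sec_in x p : K0 x -> F p (sec x p).
Proof. by case: di => _ + _ _; apply. Qed.

Lemma cintegrable_sec x y : K0 x -> K0 y ->
  cintegrable mu (fun p => hdot (sec x p) (sec y p)).
Proof. by move=> Kx Ky; case: di => _ _ /(_ x y Kx Ky)[]. Qed.

Lemma hdot_sec x y : K0 x -> K0 y ->
  hdot x y = cintegral mu (fun p => hdot (sec x p) (sec y p)).
Proof. by move=> Kx Ky; case: di => _ _ /(_ x y Kx Ky)[]. Qed.

Lemma integrable_sqnorm_sec x : K0 x ->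
  mu.-integrable setT (EFin \o (fun p => sqnorm (sec x p))).
Proof. by move=> Kx; have [] := cintegrable_sec Kx Kx. Qed.

Lemma sqnorm_sec x : K0 x -> sqnorm x = \int[mu]_p sqnorm (sec x p).
Proof. by move=> Kx; rewrite /sqnorm hdot_sec. Qed.

Lemma sqnorm_ae_sec x (v : forall p, H p) : K0 x ->
  {ae mu, forall p, sec x p = v p} ->
  mu.-integrable setT (EFin \o (fun p => sqnorm (v p))) /\
  sqnorm x = \int[mu]_p sqnorm (v p).
Proof.
move=> Kx xv; have ix := cintegrable_sec Kx Kx.
have E : {ae mu, forall p, hdot (sec x p) (sec x p) = hdot (v p) (v p)}.
  by apply: filterS xv => p ->.
split; first by have [] := cintegrable_ae cmu E ix.
by rewrite /sqnorm hdot_sec// (cintegral_ae cmu E ix).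
Qed.

Lemma hdot_self_eq0 z : K0 z -> (forall y, K0 y -> hdot z y = 0) -> z = 0.
Proof. by move=> Kz z0; apply/eqP; rewrite -sqnorm_eq0 /sqnorm z0. Qed.

Lemma di_realize (v : forall p, H p) : (forall p, F p (v p)) ->
  (forall y, K0 y -> cintegrable mu (fun p => hdot (v p) (sec y p))) ->
  exists x, [/\ K0 x, {ae mu, forall p, sec x p = v p} &
    forall y, K0 y -> hdot x y = cintegral mu (fun p => hdot (v p) (sec y p))].
Proof.
move=> Fv iv; have [x Kx xv] : exists2 x, K0 x & {ae mu, forall p, sec x p = v p}.
  by case: di => _ _ _; exact.
exists x; split=> // y Ky; rewrite hdot_sec//; apply: cintegral_ae => //.
  by apply: filterS xv => p ->.
exact: cintegrable_sec.
Qed.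

(** The difference [x - y] is orthogonal to all of [K0], itself included. *)
Lemma sec_inj x y : K0 x -> K0 y -> {ae mu, forall p, sec x p = sec y p} -> x = y.
Proof.
move=> Kx Ky xy; apply/eqP; rewrite -subr_eq0; apply/eqP/hdot_self_eq0.
  exact: di_sub.
move=> w Kw; apply/eqP; rewrite hdotBl subr_eq0 !hdot_sec//; apply/eqP.
apply: cintegral_ae => //; last exact: cintegrable_sec.
by apply: filterS xy => p ->.
Qed.

(** Linearity of [sec] is derived: the fiberwise combination is realized by some [w], and
    [w - (a *: x + y)] is orthogonal to [K0]. *)
Lemma sec_lin a x y : K0 x -> K0 y ->
  {ae mu, forall p, sec (a *: x + y) p = a *: sec x p + sec y p}.
Proof.
move=> Kx Ky.
have E p z : hdot (a *: sec x p + sec y p) (sec z p) =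
    a * hdot (sec x p) (sec z p) + hdot (sec y p) (sec z p).
  by rewrite hdotDl hdotZl.
have [|z Kz|w [Kw wE wy]] := @di_realize (fun p => a *: sec x p + sec y p).
- by move=> p; case: (hF p) => _ + _; apply; exact: sec_in.
- under eq_fun do rewrite E.
  by apply: cintegrableD; [apply: cintegrableZ|]; exact: cintegrable_sec.
- suff <- : w = a *: x + y by [].
  have Kxy := di_lin a Kx Ky.
  apply/eqP; rewrite -subr_eq0; apply/eqP/hdot_self_eq0; first exact: di_sub.
  move=> z Kz; rewrite hdotBl wy// hdotDl hdotZl.
  under eq_fun do rewrite E.
  rewrite cintegralD ?cintegralZ ?hdot_sec ?subrr//; do ?exact: cintegrable_sec.
  by apply: cintegrableZ; exact: cintegrable_sec.
Qed.

Lemma sec0 : {ae mu, forall p, sec 0 p = 0}.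
Proof.
have := sqnorm_sec di0; rewrite sqnorm0 => I0.
have : {ae mu, forall p, sqnorm (sec 0 p) = 0}.
  apply: Rintegral_ge0_eq0; [|by apply/aeW => p; exact: sqnorm_ge0|by rewrite -I0].
  exact: integrable_sqnorm_sec di0.
by apply: filterS => p /eqP; rewrite sqnorm_eq0 => /eqP.
Qed.

Lemma di_mult (f : X -> R[i]) x : cmeasurable f -> K0 x ->
  mu.-integrable setT (EFin \o (fun p => sqnorm (f p *: sec x p))) ->
  exists2 z, K0 z & {ae mu, forall p, sec z p = f p *: sec x p}.
Proof.
move=> mf Kx ifx.
have [|y Ky|z [Kz zE _]] := @di_realize (fun p => f p *: sec x p).
- move=> p; case: (hF p) => F0 Flin _.
  by rewrite -[_ *: _]addr0; apply: Flin => //; exact: sec_in.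
(* Integrability against each [y] comes from |<u, w>| <= (|u|^2 + |w|^2) / 2, applied to both
   parts. *)
- pose h p := 2^-1 * (sqnorm (f p *: sec x p) + sqnorm (sec y p)).
  apply: (@cintegrable_le _ _ _ _ _ h).
  + under eq_fun do rewrite hdotZl.
    apply: cmeasurableM => //; apply: (@cintegrable_cmeasurable _ _ _ mu).
    exact: cintegrable_sec.
  + have := integrableZl measurableT 2^-1
      (integrableD measurableT ifx (integrable_sqnorm_sec Ky)).
    exact.
  + by move=> p; rewrite /h mulrC; exact: Re_hdot_le.
  + by move=> p; rewrite /h mulrC; exact: Im_hdot_le.
- by exists z.
Qed.

Lemma di_mult_bounded (f : X -> R[i]) (c : R) x : cmeasurable f ->
  (forall p, sqmod (f p) <= c) -> K0 x ->
  exists2 z, K0 z & {ae mu, forall p, sec z p = f p *: sec x p}.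
Proof.
move=> mf fc Kx; apply: di_mult => //.
have ix := integrable_sqnorm_sec Kx.
apply: le_integrable (integrableZl measurableT c ix) => //.
  apply/measurable_EFinP; under eq_fun do rewrite sqnormZ.
  apply: measurable_funM; first exact: measurable_sqmod.
  by apply/measurable_EFinP; exact: measurable_int ix.
move=> p _; rewrite /= lee_fin !ger0_norm ?sqnorm_ge0//; last first.
  by rewrite mulr_ge0 ?sqnorm_ge0// (le_trans (sqmod_ge0 (f p))).
by rewrite sqnormZ ler_wpM2r ?sqnorm_ge0.
Qed.

(** Measurability of [v] comes for free: pairings that vanish a.e. are integrable, so the
    realization axiom provides an element with section [v], and this element is orthogonal to
    [K0]. *)
Lemma ae_orthogonal_eq0 (v : forall p, H p) : (forall p, F p (v p)) ->
  (forall y, K0 y -> {ae mu, forall p, hdot (v p) (sec y p) = 0}) ->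
  {ae mu, forall p, v p = 0}.
Proof.
move=> Fv v0.
have v0' y : K0 y -> {ae mu, forall p, 0 = hdot (v p) (sec y p)}.
  by move=> Ky; apply: filterS (v0 _ Ky) => p ->.
have [//|y Ky|z [Kz zv zy]] := @di_realize v.
  by apply: cintegrable_ae (v0' _ Ky) _ => //; exact: cintegrable0.
suff z0 : z = 0.
  by rewrite z0 in zv; apply: filterS2 zv sec0 => p -> ->.
apply: hdot_self_eq0 => // y Ky; rewrite zy//; exact/(cintegral_ae0 cmu)/v0.
Qed.

(** Pick a nonzero vector in every nonzero fiber over [B]. The resulting field is orthogonal to
    every section, hence zero a.e., so a.e. there was nothing to pick. *)
Lemma ae_fiber_eq0 (B : set X) :
  (forall x, K0 x -> {ae mu, forall p, B p -> sec x p = 0}) ->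
  {ae mu, forall p, B p -> F p `<=` [set 0]}.
Proof.
move=> xB.
pose v p : H p := if `[< B p >] then xget 0 (F p `\` [set 0]) else 0.
have Fv p : F p (v p).
  rewrite /v; case: ifP => _; last by case: (hF p).
  by case: xgetP => [y _ []//|_]; case: (hF p).
have : {ae mu, forall p, v p = 0}.
  apply: ae_orthogonal_eq0 => // y Ky.
  apply: filterS (xB _ Ky) => p yp; rewrite /v.
  by case: asboolP => [/yp ->|_]; rewrite ?hdot0r ?hdot0l.
apply: filterS => p; rewrite /v => + Bp; rewrite asboolT//.
case: xgetP => [y _ [_ /= y0] /y0 //|nF _ y Fy].
by apply: contrapT => y0; exact: (nF y).
Qed.

End DirectIntegral.

(** * Orthogonal projection and density criteria *)

Section Projection.
Variables (R : realType) (V : hilbertType R).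
Implicit Types (E : set V) (x y z : V).

Lemma hilbert_subspaceZ E a x : hilbert_subspace E -> E x -> E (a *: x).
Proof. by move=> [E0 El _] Ex; rewrite -[_ *: _]addr0; exact: El. Qed.

Lemma le_sqrt_sqnormD x y :
  Num.sqrt (sqnorm (x + y)) <= Num.sqrt (sqnorm x) + Num.sqrt (sqnorm y).
Proof. by have := ler_normD x y; rewrite !normE -rmorphD lecR. Qed.

Lemma nearest_orthogonal E x v : hilbert_subspace E -> E v ->
  (forall y, E y -> sqnorm (x - v) <= sqnorm (x - y)) ->
  forall y, E y -> hdot (x - v) y = 0.
Proof.
move=> hE Ev vmin y Ey; apply/eqP; apply: contraT => wy0.
(* Moving [v] to [v + t b y] changes the squared distance by t |b|^2 (t |y|^2 - 2). With this [t]
   one has t |y|^2 = 1 - t, so the change is -t (1 + t) |b|^2, negative unless [b] vanishes. *)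
set b := hdot (x - v) y; pose t : R := (1 + sqnorm y)^-1.
have d0 : 0 < 1 + sqnorm y by rewrite ltr_pwDl// sqnorm_ge0.
have b0 : 0 < sqmod b by rewrite lt_neqAle sqmod_ge0 andbT eq_sym sqmod_eq0.
have t0 : 0 < t by rewrite invr_gt0.
have tE : t * sqnorm y = 1 - t by rewrite /t; field; rewrite gt_eqF.
have : E ((t%:C%C * b) *: y + v) by case: hE => _ + _; apply.
move=> /vmin; rewrite opprD addrA addrAC.
rewrite [sqnorm (_ - _ *: _)]sqnormB sqnormZ hdotZr.
rewrite -/b rmorphM -mulrA [_^* * b]mulrC sqmodE sqmodM ReM ReJ ImJ /=.
rewrite !(mulr0, oppr0, mul0r, subr0) /sqmod /= expr0n addr0 -/(sqmod b).
rewrite -addrA lerDl.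
rewrite [X in 0 <= X - _](_ : _ = t * sqmod b * (t * sqnorm y)); last by ring.
rewrite tE; have := mulr_gt0 t0 b0; set u := t * sqmod b; nra.
Qed.

(** A minimizing sequence for the distance to [E] is Cauchy by the parallelogram law, and its limit
    is a nearest point. *)
Lemma projection E x : hilbert_subspace E ->
  exists2 v, E v & forall y, E y -> hdot (x - v) y = 0.
Proof.
move=> hE; have [E0 El Ec] := hE.
pose S := [set sqnorm (x - y) | y in E].
have S0 : S !=set0 by exists (sqnorm (x - 0)), 0.
have lS : has_lbound S by exists 0 => _ [y _ <-]; exact: sqnorm_ge0.
have infS y : E y -> inf S <= sqnorm (x - y).
  by move=> Ey; apply: ge_inf => //; exists y.
have near_inf n : exists y, E y /\ sqnorm (x - y) < inf S + n.+1%:R^-1.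
  have [|_ [y Ey <-] yn] := @inf_adherent _ S n.+1%:R^-1 _ (conj S0 lS).
    by rewrite invr_gt0.
  by exists y.
have [u uP] := choice near_inf.
have Eu n : E (u n) by have [] := uP n.
have invN (e : R) : 0 < e -> exists N, forall n, (N <= n)%N -> n.+1%:R^-1 < e.
  move=> e0; exists (Num.truncn e^-1) => n Nn.
  rewrite invf_plt ?posrE// (lt_le_trans (truncnS_gt _))// ler_nat ltnS//.
have [e e0|l ul] := @sqnorm_cauchy_cvg _ V u.
  have [N NP] := invN (e / 4) (divr_gt0 e0 (ltr0Sn _ _)).
  exists N => m n Nm Nn.
  have um := (uP m).2; have un := (uP n).2.
  (* The midpoint is at squared distance at least [inf S] from [x], so |u m - u n|^2 is less than 2
     / (m + 1) + 2 / (n + 1); hence the choice of [e / 4]. *)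
  have mid : E (2^-1 *: (u m + u n)).
    by apply: hilbert_subspaceZ => //; rewrite -[u m]scale1r; exact: El.
  have := infS _ mid.
  have -> : x - 2^-1 *: (u m + u n) = 2^-1 *: ((x - u m) + (x - u n)).
    rewrite [(x - u m) + _]addrACA -opprD scalerBr -[x + x]mulr2n.
    rewrite -(scaler_nat 2 x) scalerA.
    by rewrite mulVf ?scale1r// pnatr_eq0.
  have -> : u m - u n = (x - u n) - (x - u m).
    by rewrite opprB [RHS]addrC addrA subrK.
  rewrite sqnormZ sqnormB sqnormD [hdot (x - u n) _]hdotC ReJ.
  have -> : sqmod (2^-1 : R[i]) = 4^-1.
    apply: (@mulfI _ 4); rewrite ?pnatr_eq0// mulfV ?pnatr_eq0//.
    have -> : 4 = sqmod (2 : R[i]) by rewrite /sqmod /=; ring.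
    by rewrite -sqmodM mulfV ?pnatr_eq0// /sqmod /=; ring.
  move: (NP _ Nm) (NP _ Nn) um un.
  move: (m.+1%:R^-1) (n.+1%:R^-1) (sqnorm (x - u m)) (sqnorm (x - u n)) => *.
  lra.
have El' : E l.
  move/closure_id: Ec => ->; apply/closure_sqnormP => e e0.
  by have [N NP] := ul e e0; exists (u N) => //; exact: NP.
exists l => //; apply: nearest_orthogonal => //.
move=> y Ey; apply: (@le_trans _ _ (inf S)); last exact: infS.
rewrite -ler_sqrt; last by apply: lb_le_inf => // _ [z _ <-]; exact: sqnorm_ge0.
apply/ler_addgt0Pr => e e0.
(* Half of [e] pays for the distance from [l] to [u n], the other half for the excess of [u n] over
   the infimum, as sqrt (I + (e/2)^2) <= sqrt I + e/2. *)
have h0 : 0 < e / 2 by exact: divr_gt0.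
have [N1 N1P] := invN _ (exprn_gt0 2 h0).
have [N2 N2P] := ul _ (exprn_gt0 2 h0).
pose n := maxn N1 N2.
have inf0 : 0 <= inf S by apply: lb_le_inf => // _ [z _ <-]; exact: sqnorm_ge0.
have -> : x - l = (x - u n) - (l - u n) by rewrite opprB addrA subrK.
apply: (le_trans (le_sqrt_sqnormD _ _)); rewrite sqnormN.
have : Num.sqrt (sqnorm (l - u n)) <= e / 2.
  rewrite -[leRHS]ger0_norm ?(ltW h0)// -sqrtr_sqr ler_sqrt ?sqr_ge0//.
  by rewrite ltW// N2P// leq_maxr.
have : Num.sqrt (sqnorm (x - u n)) <= Num.sqrt (inf S) + e / 2.
  rewrite -[leRHS]ger0_norm ?addr_ge0 ?sqrtr_ge0 ?(ltW h0)//.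
  rewrite -sqrtr_sqr ler_sqrt ?sqr_ge0// sqrrD sqr_sqrtr//.
  apply: (le_trans (ltW (uP n).2)); rewrite -addrA lerD2l.
  apply: (@le_trans _ _ ((e / 2) ^+ 2)); first by rewrite ltW// N1P// leq_maxl.
  rewrite lerDr; apply: mulrn_wge0; apply: mulr_ge0 (ltW h0).
  exact: sqrtr_ge0.
lra.
Qed.

Lemma dense_orthogonal_eq0 E x : closure E = setT ->
  (forall y, E y -> hdot x y = 0) -> x = 0.
Proof.
move=> dE xE; apply/eqP; rewrite -sqnorm_eq0 eq_le sqnorm_ge0 andbT.
apply/ler_addgt0Pr => e e0; rewrite add0r.
have /closure_sqnormP/(_ _ e0)[y Ey] : closure E x by rewrite dE.
rewrite sqnormB xE// mulr0 subr0; have := sqnorm_ge0 y; lra.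
Qed.

(** The closure of [E] is again a subspace, and [x] minus its projection on it is orthogonal to
    [E]. *)
Lemma total_orthogonal_dense E : E 0 ->
  (forall (a : R[i]) x y, E x -> E y -> E (a *: x + y)) ->
  (forall x, (forall y, E y -> hdot x y = 0) -> x = 0) -> closure E = setT.
Proof.
move=> E0 El Eperp.
have hE : hilbert_subspace (closure E).
  split; [exact: subset_closure| |exact: closed_closure].
  move=> a x y /closure_sqnormP cx /closure_sqnormP cy.
  apply/closure_sqnormP => e e0.
  pose c := 1 + sqmod a.
  have c0 : 0 < c by rewrite ltr_pwDl// sqmod_ge0.
  have e4 : 0 < e / 4 by exact: divr_gt0.
  have [x' Ex' xx'] := cx _ (divr_gt0 e4 c0).
  have [y' Ey' yy'] := cy _ e4.
  exists (a *: x' + y'); first exact: El.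
  have -> : a *: x + y - (a *: x' + y') = a *: (x - x') + (y - y').
    by rewrite opprD addrACA -scalerBr.
  have : sqnorm (a *: (x - x')) < e / 4.
    rewrite sqnormZ; move: xx'; rewrite ltr_pdivlMr// mulrC /c => xx'.
    by have := sqnorm_ge0 (x - x'); nra.
  move: (a *: _) yy' => w; move: (y - y') => z zz ww.
  rewrite sqnormD; have := sqnorm_ge0 (w - z); rewrite sqnormB; lra.
apply/seteqP; split => // x _.
have [v cv xv] := projection x hE.
suff /eqP : x - v = 0 by rewrite subr_eq0 => /eqP ->.
by apply: Eperp => y Ey; apply: xv; exact: subset_closure.
Qed.

End Projection.

(** * The von Neumann algebra of bounded multiplication operators *)

Section DiagonalAlgebra.
Variables (R : realType) (d : measure_display) (X : topMeasurableType d).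
Variable mu : {measure set X -> \bar R}.
Hypothesis cmu : measure_is_complete mu.
Variables (H : X -> hilbertType R) (K : hilbertType R) (sec : K -> forall p, H p).
Hypothesis diK : direct_integral mu (fun p => [set: H p]) [set: K] sec.

Let hT p : hilbert_subspace [set: H p].
Proof. by split => //; exact: closedT. Qed.

Implicit Types (f : X -> R[i]) (S T : K -> K).

Definition multiplies f S :=
  forall x, {ae mu, forall p, sec (S x) p = f p *: sec x p}.

(** This algebra turns out to be the range of the extension map. *)
Definition diagonal_bounded : set (K -> K) :=
  [set S | bounded_operator S /\ multiplication_on mu sec setT S].

Lemma diagonal_boundedP S : diagonal_bounded S <->
  bounded_operator S /\ exists2 f, cmeasurable f & multiplies f S.
Proof.
by split=> -[bS [f mf fS]]; split => //; exists f => // x; exact: fS.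
Qed.

(** Serves for operators obtained by choosing a realization for each [x]: since [sec] is injective
    up to null sets, fiberwise linearity suffices. *)
Lemma multiplies_linear f S : multiplies f S -> linear_on setT S.
Proof.
move=> fS a x y _ _; apply: (sec_inj cmu diK) => //.
have E1 := sec_lin cmu hT diK a (I : setT x) (I : setT y).
have E2 := sec_lin cmu hT diK a (I : setT (S x)) (I : setT (S y)).
apply: filterS3 (filterI (fS x) (fS y)) (filterI E1 E2) (fS (a *: x + y)).
by move=> p [eSx eSy] [-> ->] ->; rewrite eSx eSy scalerDr !scalerA mulrC.
Qed.

Lemma multiplies_unique f S T : multiplies f S -> multiplies f T -> S = T.
Proof.
move=> fS fT; apply/funext => x; apply: (sec_inj cmu diK) => //.
by apply: filterS2 (fS x) (fT x) => p -> ->.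
Qed.

Lemma multiplies_comp f g S T : multiplies f S -> multiplies g T ->
  multiplies (fun p => f p * g p) (S \o T).
Proof.
by move=> fS gT x; apply: filterS2 (fS (T x)) (gT x) => p /= -> ->; rewrite scalerA.
Qed.

Lemma diagonal_bounded0 : diagonal_bounded (fun=> 0).
Proof.
apply/diagonal_boundedP; split.
  split; first by move=> a x y _ _; rewrite scaler0 addr0.
  by apply/bounded_on_sqnormP; exists 0 => // x _; rewrite sqnorm0 mul0r.
exists (fun=> 0); first exact: cmeasurable_cst.
by move=> x; apply: filterS (sec0 diK) => p ->; rewrite scale0r.
Qed.

Lemma diagonal_bounded_id : diagonal_bounded id.
Proof.
apply/diagonal_boundedP; split.
  split=> //.
  by apply/bounded_on_sqnormP; exists 1 => // x _; rewrite mul1r.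
exists (fun=> 1); first exact: cmeasurable_cst.
by move=> x; apply/aeW => p; rewrite scale1r.
Qed.

Lemma diagonal_bounded_lin a S T : diagonal_bounded S -> diagonal_bounded T ->
  diagonal_bounded (fun x => a *: S x + T x).
Proof.
move=> /diagonal_boundedP[[lS /bounded_on_sqnormP[c c0 Sc]] [f mf fS]].
move=> /diagonal_boundedP[[lT /bounded_on_sqnormP[c' c'0 Tc]] [g mg gT]].
have fg : multiplies (fun p => a * f p + g p) (fun x => a *: S x + T x).
  move=> x; have E := sec_lin cmu hT diK a (I : setT (S x)) (I : setT (T x)).
  apply: filterS3 (fS x) (gT x) E => p eS eT ->.
  by rewrite eS eT scalerDl scalerA.
apply/diagonal_boundedP; split; last first.
  exists (fun p => a * f p + g p) => //.
  apply: cmeasurableD => //; apply: cmeasurableM => //; exact: cmeasurable_cst.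
split; first exact: multiplies_linear fg.
apply/bounded_on_sqnormP; exists (2 * sqmod a * c + 2 * c').
  by rewrite addr_ge0// !mulr_ge0// sqmod_ge0.
move=> x _; apply: (@le_trans _ _ (2 * sqnorm (a *: S x) + 2 * sqnorm (T x))).
  by rewrite sqnormD; have := sqnorm_ge0 (a *: S x - T x); rewrite sqnormB; lra.
rewrite sqnormZ [leRHS]mulrDl -!mulrA; apply: lerD; rewrite ler_wpM2l//.
  by rewrite ler_wpM2l ?sqmod_ge0// Sc.
exact: Tc.
Qed.

Lemma diagonal_bounded_comp S T : diagonal_bounded S -> diagonal_bounded T ->
  diagonal_bounded (S \o T).
Proof.
move=> /diagonal_boundedP[[lS /bounded_on_sqnormP[c c0 Sc]] [f mf fS]].
move=> /diagonal_boundedP[[lT /bounded_on_sqnormP[c' c'0 Tc]] [g mg gT]].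
have fg := multiplies_comp fS gT.
apply/diagonal_boundedP; split; last first.
  by exists (fun p => f p * g p) => //; exact: cmeasurableM.
split; first exact: multiplies_linear fg.
apply/bounded_on_sqnormP; exists (c * c'); first exact: mulr_ge0.
by move=> x _; rewrite -mulrA (le_trans (Sc _ I))// ler_wpM2l// Tc.
Qed.

Lemma diagonal_bounded_commute S T : diagonal_bounded S -> diagonal_bounded T ->
  S \o T = T \o S.
Proof.
move=> /diagonal_boundedP[_ [f mf fS]] /diagonal_boundedP[_ [g mg gT]].
apply: (multiplies_unique (multiplies_comp fS gT)).
by under [fun p => _]eq_fun do rewrite mulrC; exact: multiplies_comp.
Qed.

(** The adjoint multiplies by the conjugate symbol. The product is square integrable because its
    fiberwise norm is that of [S x], and the norm bound carries over for the same reason. *)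
Lemma diagonal_bounded_adjoint S : diagonal_bounded S ->
  exists2 S', diagonal_bounded S' & adjoint_on setT S S'.
Proof.
move=> /diagonal_boundedP[[lS /bounded_on_sqnormP[c c0 Sc]] [f mf fS]].
have mf' := cmeasurableJ mf.
have sqE p (x : K) : sqnorm ((f p)^* *: sec x p) = sqnorm (f p *: sec x p).
  by rewrite !sqnormZ sqmodJ.
have /choice[S' fS'] x : exists z, {ae mu, forall p, sec z p = (f p)^* *: sec x p}.
  have [|z _ zx] := di_mult cmu hT diK mf' (I : setT x); last by exists z.
  under eq_fun do rewrite /= sqE.
  by have [] := sqnorm_ae_sec cmu diK (I : setT (S x)) (fS x).
exists S'.
  apply/diagonal_boundedP; split; last by exists (fun p => (f p)^*).
  split; first exact: multiplies_linear fS'.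
  apply/bounded_on_sqnormP; exists c => // x _.
  suff -> : sqnorm (S' x) = sqnorm (S x) by exact: Sc.
  have [_ ->] := sqnorm_ae_sec cmu diK (I : setT (S' x)) (fS' x).
  have [_ ->] := sqnorm_ae_sec cmu diK (I : setT (S x)) (fS x).
  by apply: eq_Rintegral => p _; rewrite sqE.
move=> x y _ _; rewrite !(hdot_sec diK)//.
apply: cintegral_ae => //; last exact: (cintegrable_sec diK).
by apply: filterS2 (fS x) (fS' y) => p -> ->; rewrite hdotZl hdotZr conjCK.
Qed.

Lemma diagonal_bounded_star_subalgebra :
  star_subalgebra [set: K] diagonal_bounded.
Proof.
split; [exact: diagonal_bounded0|exact: diagonal_bounded_lin|
  exact: diagonal_bounded_comp|exact: diagonal_bounded_adjoint].
Qed.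

(** For a multiplication operator [T] the two coefficients coincide, being integrals of the symbol
    against the same function. A [T] close to [S] on both pairs, within half the supposed gap, gives
    a contradiction. *)
Lemma wot_adherent_diagonal_hdot S x1 y1 x2 y2 :
  wot_adherent diagonal_bounded S ->
  {ae mu, forall p, hdot (sec x1 p) (sec y1 p) = hdot (sec x2 p) (sec y2 p)} ->
  hdot (S x1) y1 = hdot (S x2) y2.
Proof.
move=> wS xy; apply/eqP; rewrite -subr_eq0; apply: contraT => ne0.
set e := `|hdot (S x1) y1 - hdot (S x2) y2| / 2.
have e0 : 0 < e by rewrite divr_gt0// normr_gt0.
have [T /diagonal_boundedP[_ [f mf fT]] TS] := wS [:: (x1, y1); (x2, y2)] e e0.
have := TS (x1, y1) (mem_head _ _).
have := TS (x2, y2); rewrite !inE eqxx orbT => /(_ isT) /=.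
have -> : hdot (T x1) y1 = hdot (T x2) y2.
  rewrite !(hdot_sec diK)//.
  apply: cintegral_ae => //; last exact: (cintegrable_sec diK).
  by apply: filterS3 xy (fT x1) (fT x2) => p + -> ->; rewrite !hdotZl => ->.
move=> h2 h1; have := ler_distD (hdot (T x2) y2) (hdot (S x1) y1) (hdot (S x2) y2).
move/le_lt_trans => /(_ (e + e)); rewrite ltrD ?[`|hdot (T _) _ - _|]distrC//.
by move=> /(_ isT); rewrite -splitr ltxx.
Qed.

(* With h = <x(p), y(p)> and q = |xi(p)|^2, the weights q^2 / den and
   h q / den for den = 1 + q^2 + |h|^2 are bounded and turn the pairs (x, y) and
   (xi, xi) into pairs with the same fiberwise inner product h q^2 / den. *)
Lemma wot_adherent_diagonal_ratio S x y xi :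
  wot_adherent diagonal_bounded S ->
  {ae mu, forall p,
    (sqnorm (sec xi p) ^+ 2)%:C%C * hdot (sec (S x) p) (sec y p) =
    (sqnorm (sec xi p))%:C%C * hdot (sec x p) (sec y p) *
      hdot (sec (S xi) p) (sec xi p)}.
Proof.
move=> wS.
pose q p := sqnorm (sec xi p); pose h p := hdot (sec x p) (sec y p).
pose den p := 1 + (q p ^+ 2 + sqmod (h p)).
have q0 p : 0 <= q p by exact: sqnorm_ge0.
have den0 p : 0 < den p by rewrite ltr_pwDl// addr_ge0 ?sqr_ge0 ?sqmod_ge0.
have mh : cmeasurable h.
  by apply: (@cintegrable_cmeasurable _ _ _ mu); exact: (cintegrable_sec diK).
have mq : measurable_fun setT q.
  by apply/measurable_EFinP; exact: measurable_int (integrable_sqnorm_sec diK _).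
have mdenV : measurable_fun setT (fun p => (den p)^-1).
  apply: measurable_inv => [p|]; first exact: ltW.
  apply: measurable_funD => //; apply: measurable_funD.
    exact: measurable_funX.
  exact: measurable_sqmod.
pose a p := (q p ^+ 2 / den p)%:C%C : R[i].
pose b p := h p * (q p / den p)%:C%C.
have ma : cmeasurable a.
  by apply: cmeasurable_real; apply: measurable_funM => //; exact: measurable_funX.
have mb : cmeasurable b.
  by apply: cmeasurableM => //; apply: cmeasurable_real; exact: measurable_funM.
have a1 p : sqmod (a p) <= 1.
  rewrite /sqmod /= expr0n addr0 expr_le1// ?divr_ge0 ?sqr_ge0 ?ltW//.
  rewrite ltr_pdivrMr// mul1r /den; have := sqmod_ge0 (h p); lra.
have b1 p : sqmod (b p) <= 1.
  rewrite sqmodM [X in _ * X]/sqmod /= expr0n addr0 expr_div_n mulrA.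
  rewrite ler_pdivrMr ?exprn_gt0// mul1r /den.
  by have := sqmod_ge0 (h p); have := sqr_ge0 (q p); nra.
(* The weights [psi a] and [psi b] enter through their conjugates on the second arguments [y] and
   [xi], so that [S] is still applied to [x] and [xi] themselves. *)
have pair psi : cmeasurable psi -> (forall p, sqmod (psi p) <= 1) ->
    cintegrable mu (fun p => psi p * (a p * hdot (sec (S x) p) (sec y p)
                             - b p * hdot (sec (S xi) p) (sec xi p))) /\
    cintegral mu (fun p => psi p * (a p * hdot (sec (S x) p) (sec y p)
                             - b p * hdot (sec (S xi) p) (sec xi p))) = 0.
  move=> mpsi psi1.
  have bnd g p : sqmod (g p) <= 1 -> sqmod ((psi p * g p)^*) <= 1.
    by move=> g1; rewrite sqmodJ sqmodM mulr_ile1// sqmod_ge0.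
  have [y' _ y'E] := di_mult_bounded cmu hT diK
    (cmeasurableJ (cmeasurableM mpsi ma)) (fun p => bnd a p (a1 p)) (I : setT y).
  have [xi' _ xi'E] := di_mult_bounded cmu hT diK
    (cmeasurableJ (cmeasurableM mpsi mb)) (fun p => bnd b p (b1 p)) (I : setT xi).
  have SE : hdot (S x) y' = hdot (S xi) xi'.
    apply: wot_adherent_diagonal_hdot => //.
    apply: filterS2 y'E xi'E => p -> ->.
    rewrite !hdotZr !conjCK [hdot (sec xi p) _]hdotxx -/(h p) -/(q p) /a /b.
    rewrite -!mulrA; congr (_ * _); rewrite mulrC; congr (_ * _).
    by rewrite -rmorphM /=; congr (_%:C%C); ring.
  have E1 : {ae mu, forall p, hdot (sec (S x) p) (sec y' p) =
      psi p * (a p * hdot (sec (S x) p) (sec y p))}.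
    by apply: filterS y'E => p ->; rewrite hdotZr conjCK [RHS]mulrA.
  have E2 : {ae mu, forall p, hdot (sec (S xi) p) (sec xi' p) =
      psi p * (b p * hdot (sec (S xi) p) (sec xi p))}.
    by apply: filterS xi'E => p ->; rewrite hdotZr conjCK [RHS]mulrA.
  have i1 := cintegrable_sec diK (I : setT (S x)) (I : setT y').
  have i2 := cintegrable_sec diK (I : setT (S xi)) (I : setT xi').
  have j1 := cintegrable_ae cmu E1 i1.
  have j2 := cintegrableZ (-1) (cintegrable_ae cmu E2 i2).
  have E p : psi p * (a p * hdot (sec (S x) p) (sec y p)
                      - b p * hdot (sec (S xi) p) (sec xi p)) =
      psi p * (a p * hdot (sec (S x) p) (sec y p)) +
      -1 * (psi p * (b p * hdot (sec (S xi) p) (sec xi p))).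
    by rewrite mulrBr mulN1r.
  under eq_fun do rewrite E; split; first exact: cintegrableD.
  rewrite cintegralD// cintegralZ; last first.
    exact: (cintegrable_ae cmu E2 i2).
  rewrite -(cintegral_ae cmu E1 i1) -(cintegral_ae cmu E2 i2).
  by rewrite -!(hdot_sec diK)// SE mulN1r subrr.
have iu : cintegrable mu (fun p => a p * hdot (sec (S x) p) (sec y p)
                             - b p * hdot (sec (S xi) p) (sec xi p)).
  have [|i1 _] := pair _ (cmeasurable_cst X 1).
    by move=> p; rewrite /sqmod /= expr1n expr0n addr0.
  by apply: (cintegrable_ae cmu _ i1); apply/aeW => p; rewrite mul1r.
have := cintegral_test_eq0 iu (fun psi mpsi psi1 => (pair psi mpsi psi1).2).
apply: filterS => p /eqP; rewrite subr_eq0 => /eqP.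
move=> /(congr1 ( *%R (den p)%:C%C)); rewrite /a /b !mulrA.
rewrite [_ * h p]mulrC -[h p * _ * _]mulrA -!rmorphM /=.
rewrite ![den p * _]mulrC !divfK ?gt_eqF// => ->.
by rewrite [h p * _]mulrC.
Qed.

Lemma wot_adherent_diagonal_bounded S : separable_set [set: K] ->
  bounded_operator S -> wot_adherent diagonal_bounded S -> diagonal_bounded S.
Proof.
move=> [D cD [_ dD]] bS wS.
have {}dD : closure D = setT by apply/seteqP; split => // x _; exact: dD.
have [xi DE] : exists xi : nat -> K, D = xi @` setT.
  move: cD; rewrite /countable => /pfcard_geP[D0|/surjfunPex//].
  have : closure D 0 by rewrite dD.
  by rewrite D0 closure0.
pose A n := [set p | sqnorm (sec (xi n) p) != 0].
have mq n : measurable_fun setT (fun p => sqnorm (sec (xi n) p)).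
  by apply/measurable_EFinP; exact: measurable_int (integrable_sqnorm_sec diK _).
have mA n : measurable (A n).
  have -> : A n = (fun p => sqnorm (sec (xi n) p) == 0) @^-1` [set false].
    by apply/seteqP; split=> p /=; rewrite /A /=; case: eqP.
  rewrite -[_ @^-1` _]setTI.
  have m := measurable_fun_eqr (mq n) (@measurable_cst _ _ X R setT 0).
  by apply: m.
pose U := \bigcup_n A n.
have mU : measurable U by exact: bigcupT_measurable.
(* Cutting [z] off to the complement of [U] gives an element orthogonal to every [xi n], hence zero
   by density. *)
have vanish (z : K) : {ae mu, forall p, ~ U p -> sec z p = 0}.
  pose f p : R[i] := if `[< U p >] then 0 else 1.
  have mf : cmeasurable f.
    apply: cmeasurable_if; [|exact: cmeasurable_cst..].
    apply: (measurable_fun_bool true); rewrite setTI.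
    by rewrite (_ : _ @^-1` _ = U)//; apply/seteqP; split=> p /asboolP.
  have f1 p : sqmod (f p) <= 1.
    by rewrite /f /sqmod; case: ifP => _ /=; rewrite ?expr1n expr0n addr0.
  have [z' _ z'E] := di_mult_bounded cmu hT diK mf f1 (I : setT z).
  have z'0 : z' = 0.
    apply: (dense_orthogonal_eq0 dD) => y; rewrite DE => -[n _ <-].
    rewrite (hdot_sec diK)//; apply: (cintegral_ae0 cmu).
    apply: filterS z'E => p ->; rewrite hdotZl /f.
    case: asboolP => [_|nU]; first by rewrite mul0r.
    have /eqP : sqnorm (sec (xi n) p) == 0.
      by apply/negPn/negP => np; apply: nU; exists n.
    by move/eqP; rewrite sqnorm_eq0 => /eqP ->; rewrite hdot0r mulr0.
  rewrite z'0 in z'E; apply: filterS2 z'E (sec0 diK) => p -> + nU.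
  by rewrite /f asboolF// scale1r.
(* [N p] is the first index at which the sequence does not vanish at [p]. Off [U] it defaults to 0,
   so the preimage of 0 also contains the complement of [U]. *)
have /choice[N NP] p : exists n, seqDU A n p \/ n = 0%N /\ ~ U p.
  have [|nU] := pselect (U p); last by exists 0%N; right.
  by rewrite /U seqDU_bigcup_eq => -[n _ An]; exists n; left.
have AU n p : seqDU A n p -> U p by move=> An; exists n => //; exact: subset_seqDU An.
have mN n : measurable (N @^-1` [set n]).
  have -> : N @^-1` [set n] = seqDU A n `|` (if n == 0%N then ~` U else set0).
    apply/seteqP; split=> p /=.
      by move=> <-; case: (NP p) => [|[-> nU]]; [left|right].
    case=> [Anp|]; case: (NP p) => [ANp|[-> nU]].
    - by apply: (@trivIset_seqDU _ A) => //; exists p.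
    - by have := nU (AU _ _ Anp).
    - by case: ifP => // _ /(_ (AU _ _ ANp)).
    - by case: eqP.
  apply: measurableU; first exact: seqDU_measurable.
  by case: ifP => // _; exact: measurableC.
(* The ratio identity with [x] = [xi n] leaves this as the only possible value of the symbol where
   [xi n] does not vanish. *)
pose g n p := hdot (sec (S (xi n)) p) (sec (xi n) p) *
  ((sqnorm (sec (xi n) p))^-1)%:C%C.
have mg n : cmeasurable (g n).
  apply: cmeasurableM.
    by apply: (@cintegrable_cmeasurable _ _ _ mu); exact: (cintegrable_sec diK).
  by apply/cmeasurable_real/measurable_inv => // p; exact: sqnorm_ge0.
apply/diagonal_boundedP; split => //; exists (fun p => g (N p) p).
  split; [have := measurable_fun_select mN (fun n => (mg n).1)
         |have := measurable_fun_select mN (fun n => (mg n).2)]; exact.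
move=> x.
have : {ae mu, forall p, sec (S x) p - g (N p) p *: sec x p = 0}.
  apply: (ae_orthogonal_eq0 cmu diK) => // y _.
  have R1 : {ae mu, forall p n, 
    (sqnorm (sec (xi n) p) ^+ 2)%:C%C * hdot (sec (S x) p) (sec y p) =
    (sqnorm (sec (xi n) p))%:C%C * hdot (sec x p) (sec y p) *
      hdot (sec (S (xi n)) p) (sec (xi n) p)}.
    apply/ae_foralln => n; exact: wot_adherent_diagonal_ratio.
  apply: filterS3 R1 (vanish x) (vanish (S x)) => p Rp x0 Sx0.
  have [Up|nU] := pselect (U p); last first.
    by rewrite x0// Sx0// scaler0 subr0 hdot0l.
  have Np : (sqnorm (sec (xi (N p)) p))%:C%C != 0 :> R[i].
    have : A (N p) p by case: (NP p) => [h|[]//]; exact: subset_seqDU h.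
    by rewrite /A /= eq_complex /= eqxx andbT.
  rewrite hdotBl hdotZl; apply/eqP; rewrite subr_eq0; apply/eqP.
  apply: (mulfI (expf_neq0 2 Np)); rewrite -rmorphXn [LHS]Rp /g fmorphV.
  by field.
by apply: filterS => p /eqP; rewrite subr_eq0 => /eqP.
Qed.


End DiagonalAlgebra.

(** * Passing between local and global diagonal operators *)

Section LocalDiagonal.
Variables (R : realType) (dL : Order.disp_t) (L : porderType dL).
Hypothesis dirL : directed L.
Variables (d : measure_display) (X : topMeasurableType d).
Variable mu : {measure set X -> \bar R}.
Hypothesis cmu : measure_is_complete mu.
Variables (H : X -> hilbertType R) (E : L -> forall p, set (H p)).
Arguments E : clear implicits.
Hypothesis qdE : forall p, quantized_domain (fun a => E a p).
Variables (K : hilbertType R) (sec : K -> forall p, H p).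
Hypothesis diK : direct_integral mu (fun p => [set: H p]) [set: K] sec.
Variables (KE : L -> set K) (secE : L -> K -> forall p, H p).
Hypothesis diKE : forall a, direct_integral mu (E a) (KE a) (secE a).
Hypothesis siKE : strictly_inductive KE.
Hypothesis sec_secE :
  forall a x, KE a x -> {ae mu, forall p, secE a x p = sec x p}.

Local Notation D := (locally_hilbert KE).
Local Notation DIAG := (diagonalizable_op mu E KE sec).
Local Notation BDIAG := (diagonal_bounded mu sec).

Let hT p : hilbert_subspace [set: H p].
Proof. by split => //; exact: closedT. Qed.

Let hE a p : hilbert_subspace (E a p).
Proof. by have [[]] := qdE p. Qed.

Lemma locally_hilbert_lin (V : hilbertType R) (F : L -> set V) (a : R[i]) x y :
  strictly_inductive F -> locally_hilbert F x -> locally_hilbert F y ->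
  locally_hilbert F (a *: x + y).
Proof.
move=> [hF incF] [b _ bx] [c _ cy].
have [e [be ce]] := dirL.2 b c; exists e => //.
by case: (hF e) => _ + _; apply; [exact: incF be _ bx|exact: incF ce _ cy].
Qed.

Lemma locally_hilbert0 (V : hilbertType R) (F : L -> set V) :
  strictly_inductive F -> locally_hilbert F 0.
Proof. by move=> [hF _]; have [[a _] _] := dirL; exists a => //; case: (hF a). Qed.

Lemma sec_in_fiber a x : KE a x -> {ae mu, forall p, E a p (sec x p)}.
Proof.
move=> ax; apply: filterS (sec_secE ax) => p <-.
exact: (sec_in (diKE a)).
Qed.

(** As [S x] exists in [K], the field [f x] is square integrable; its values lie in the fibers of
    index [a], so it is realized in [KE a], and [sec_inj] identifies the two elements. *)
Lemma multiplies_stable f S a x : cmeasurable f -> multiplies mu sec f S ->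
  KE a x -> KE a (S x).
Proof.
move=> mf fS ax.
have E1 : {ae mu, forall p, sec (S x) p = f p *: secE a x p}.
  by apply: filterS2 (fS x) (sec_secE ax) => p -> ->.
have [ifx _] := sqnorm_ae_sec cmu diK (I : setT (S x)) E1.
have [z az zE] := di_mult cmu (hE a) (diKE a) mf ax ifx.
suff -> : S x = z by [].
apply: (sec_inj cmu diK) => //.
by apply: filterS3 E1 zE (sec_secE az) => p -> + <- => ->.
Qed.

Definition restrict_op (S : K -> K) x : K := if `[< D x >] then S x else 0.

Lemma restrict_opE S x : D x -> restrict_op S x = S x.
Proof. by move=> Dx; rewrite /restrict_op asboolT. Qed.

Lemma restrict_op_out S x : ~ D x -> restrict_op S x = 0.
Proof. by move=> Dx; rewrite /restrict_op asboolF. Qed.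

Lemma restrict_op_diagonalizable S : BDIAG S -> DIAG (restrict_op S).
Proof.
move=> BS; have [S' /diagonal_boundedP[_ [f' mf' fS']] SS'] :=
  diagonal_bounded_adjoint cmu diK BS.
have /diagonal_boundedP[[lS bS] [f mf fS]] := BS.
have KED a x : KE a x -> D x by exists a.
have stable a x : KE a x -> KE a (S x) by exact: (multiplies_stable mf fS).
split; last first.
  by exists f => // x Dx; rewrite restrict_opE//; exact: fS.
split.
  split; first exact: restrict_op_out.
    move=> a x y Dx Dy; rewrite !restrict_opE//; first exact: lS.
    exact: locally_hilbert_lin.
  move=> a; split.
  - by move=> x ax; rewrite restrict_opE; [exact: stable|exact: (KED _ _ ax)].
  (* Orthogonal complements are preserved because the adjoint [S'], also a multiplication operator,
     preserves [KE a]. *)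
  - move=> x Dx xperp y ay; rewrite restrict_opE// SS'//.
    by apply: xperp; exact: (multiplies_stable mf' fS' ay).
  - have [M SM] := bS; exists M => x ax.
    by rewrite restrict_opE; [exact: SM|exact: (KED _ _ ax)].
pose ED p := locally_hilbert (fun a => E a p).
(* The fiber operators are scalars on the locally Hilbert spaces, extended by 0; a.e. value of a
   section of [D] lies where they act as scalars. *)
exists (fun p z => if `[< ED p z >] then f p *: z else 0).
  move=> p; have [siE _] := qdE p.
  have EDE z : ED p z -> (if `[< ED p z >] then f p *: z else 0) = f p *: z.
    by move=> Dz; rewrite asboolT.
  split; first by move=> z Dz; rewrite asboolF.
    move=> a x y Dx Dy; rewrite !EDE//; last exact: locally_hilbert_lin.
    by rewrite scalerDr !scalerA mulrC.
  move=> a; split.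
  - move=> z az; rewrite EDE; last by exists a.
    exact: hilbert_subspaceZ.
  - by move=> z Dz zperp y ay; rewrite EDE// hdotZl zperp// mulr0.
  - apply/bounded_on_sqnormP; exists (sqmod (f p)); first exact: sqmod_ge0.
    by move=> z az; rewrite EDE ?sqnormZ//; exists a.
move=> u [a _ au]; apply: filterS2 (sec_in_fiber au) (fS u) => p Eu fSu.
by rewrite restrict_opE ?asboolT//; exists a.
Qed.

(** * Control of symbols through one well-supported index *)

Section Support.
Hypothesis supp : exists a, {ae mu, forall p,
  E a p `<=` [set 0] -> [set: H p] `<=` [set 0]}.

(** The single index given by [supp] decides, which avoids a union of null sets over all of [L]. *)
Lemma ae_eq0_of_local (B : set X) :
  (forall x, D x -> {ae mu, forall p, B p -> sec x p = 0}) ->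
  {ae mu, forall p, B p -> [set: H p] `<=` [set 0]}.
Proof.
move=> DB; have [a suppa] := supp.
have aB x : KE a x -> {ae mu, forall p, B p -> secE a x p = 0}.
  move=> ax; have Dx : D x by exists a.
  by apply: filterS2 (DB _ Dx) (sec_secE ax) => p + ->.
have := ae_fiber_eq0 cmu (hE a) (diKE a) aB.
by apply: filterS2 suppa => p + EB Bp; apply; exact: EB.
Qed.

Lemma diagonal_bounded_inj S T : BDIAG S -> BDIAG T ->
  (forall x, D x -> S x = T x) -> S = T.
Proof.
move=> /diagonal_boundedP[_ [f mf fS]] /diagonal_boundedP[_ [g mg gT]] ST.
have H0 : {ae mu, forall p, f p <> g p -> [set: H p] `<=` [set 0]}.
  apply: (@ae_eq0_of_local [set p | f p <> g p]) => x Dx.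
  apply: filterS2 (fS x) (gT x) => p; rewrite ST// => -> /eqP.
  rewrite -subr_eq0 -scalerBl scaler_eq0 subr_eq0.
  by move=> /orP[/eqP fg /(_ fg)//|/eqP//].
apply/funext => x; apply: (sec_inj cmu diK) => //.
apply: filterS3 H0 (fS x) (gT x) => p Hp -> ->.
have [-> //|/eqP fg] := eqVneq (f p) (g p).
by rewrite (Hp fg (sec x p) I) !scaler0.
Qed.

(** Let [c] bound [T] on [KE a] for the index [a] of [supp]. Cut an element of [KE a] off to the set
    where |f|^2 > c: the bound forces the integral of (|f|^2 - c) |x|^2 over that set to be at most
    0, so [x] vanishes there a.e. *)
Lemma diagonalizable_ess_bounded T f : locally_bounded KE T -> cmeasurable f ->
  (forall u, D u -> {ae mu, forall p, sec (T u) p = f p *: sec u p}) ->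
  exists2 c : R, 0 <= c &
    {ae mu, forall p, c < sqmod (f p) -> [set: H p] `<=` [set 0]}.
Proof.
move=> [_ _ lbT] mf fT; have [a suppa] := supp.
have [_ _ /bounded_on_sqnormP[c c0 Tc]] := lbT a; exists c => //.
pose B p := c < sqmod (f p).
have mB : measurable_fun setT B.
  by apply: measurable_fun_ltr => //; exact: measurable_sqmod.
have aB x : KE a x -> {ae mu, forall p, B p -> secE a x p = 0}.
  move=> ax; pose phi p : R[i] := if B p then 1 else 0.
  have mphi : cmeasurable phi.
    by apply: cmeasurable_if => //; exact: cmeasurable_cst.
  have phi1 p : sqmod (phi p) <= 1.
    by rewrite /phi /sqmod; case: ifP => _ /=; rewrite ?expr1n expr0n addr0.
  have [y ay yE] := di_mult_bounded cmu (hE a) (diKE a) mphi phi1 ax.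
  have Dy : D y by exists a.
  have yE' : {ae mu, forall p, sec y p = phi p *: secE a x p}.
    by apply: filterS2 yE (sec_secE ay) => p + <-.
  have TyE : {ae mu, forall p, sec (T y) p = (f p * phi p) *: secE a x p}.
    by apply: filterS2 (fT _ Dy) yE' => p -> ->; rewrite scalerA.
  have [iy nyE] := sqnorm_ae_sec cmu diK (I : setT y) yE'.
  have [iTy nTyE] := sqnorm_ae_sec cmu diK (I : setT (T y)) TyE.
  have icy := integrableZl measurableT c iy.
  have : {ae mu, forall p, sqnorm ((f p * phi p) *: secE a x p) -
                           c * sqnorm (phi p *: secE a x p) = 0}.
    apply: Rintegral_ge0_eq0.
    - exact: (integrableB measurableT iTy icy).
    - apply/aeW => p; rewrite -scalerA sqnormZ -mulrBl /phi.
      case: ifPn => [Bp|_]; last by rewrite scale0r sqnorm0 mulr0.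
      by rewrite mulr_ge0 ?sqnorm_ge0// subr_ge0 ltW.
    - rewrite RintegralB// RintegralZl// -nTyE -nyE subr_le0.
      exact: Tc.
  apply: filterS => p /eqP + Bp; rewrite /phi Bp mulr1 scale1r sqnormZ -mulrBl.
  by rewrite mulf_eq0 subr_eq0 gt_eqF//= sqnorm_eq0 => /eqP.
have := ae_fiber_eq0 cmu (hE a) (diKE a) aB.
by apply: filterS2 suppa => p + EB Bp; apply; exact: EB.
Qed.

Lemma diagonalizable_extends T : DIAG T ->
  exists2 S, BDIAG S & forall x, D x -> S x = T x.
Proof.
move=> [[lbT _] [f mf fT]].
have [c c0 fc] := diagonalizable_ess_bounded lbT mf fT.
(* Truncation makes the symbol bounded everywhere and alters it, up to a null set, only where [H p]
   is zero. *)
pose g p := if sqmod (f p) <= c then f p else 0.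
have mg : cmeasurable g.
  apply: cmeasurable_if => //.
  by apply: measurable_fun_ler => //; exact: measurable_sqmod.
have gc p : sqmod (g p) <= c.
  by rewrite /g; case: ifP => // _; rewrite /sqmod /= expr0n addr0.
have /choice[S gS] x : exists z, {ae mu, forall p, sec z p = g p *: sec x p}.
  by have [z _ zE] := di_mult_bounded cmu hT diK mg gc (I : setT x); exists z.
exists S; last first.
  move=> x Dx; apply: (sec_inj cmu diK) => //.
  apply: filterS3 fc (fT _ Dx) (gS x) => p Hp -> ->; rewrite /g.
  by case: leP => // /Hp Hp0; rewrite (Hp0 (sec x p) I) !scaler0.
apply/diagonal_boundedP; split; last by exists g.
split; first exact: (multiplies_linear cmu diK gS).
apply/bounded_on_sqnormP; exists c => // x _.
have [iS ->] := sqnorm_ae_sec cmu diK (I : setT (S x)) (gS x).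
have ix := integrable_sqnorm_sec diK (I : setT x).
rewrite (sqnorm_sec diK)// -RintegralZl//; apply: le_Rintegral => //.
  exact: (integrableZl measurableT c ix).
by move=> p _; rewrite sqnormZ ler_wpM2r ?sqnorm_ge0.
Qed.

End Support.

(** Stability of [KE a] under bounded multipliers makes orthogonality fiberwise for each section.
    The projections of [sec x p] on [E a p] then form a field orthogonal to all sections, which is
    zero a.e. *)
Lemma local_orthogonal_fiber a x : (forall y, KE a y -> hdot x y = 0) ->
  {ae mu, forall p z, E a p z -> hdot (sec x p) z = 0}.
Proof.
move=> xperp.
have sperp u : KE a u -> {ae mu, forall p, hdot (sec x p) (sec u p) = 0}.
  move=> au; apply: (cintegral_test_eq0 (cintegrable_sec diK _ _)) => //.
  move=> psi mpsi psi1.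
  have psi1' p : sqmod (psi p)^* <= 1 by rewrite sqmodJ.
  have [z az zE] :=
    di_mult_bounded cmu (hE a) (diKE a) (cmeasurableJ mpsi) psi1' au.
  rewrite -(xperp z az) (hdot_sec diK)//.
  apply/esym/(cintegral_ae cmu); last exact: (cintegrable_sec diK).
  apply: filterS3 zE (sec_secE az) (sec_secE au) => p + <- <- => ->.
  by rewrite hdotZr conjCK.
have pr p := cid2 (projection (sec x p) (hE a p)).
pose v p := s2val (pr p).
have vE p : E a p (v p) by exact: (s2valP (pr p)).
have vP p y : E a p y -> hdot (sec x p - v p) y = 0 by exact: (s2valP' (pr p)).
have : {ae mu, forall p, v p = 0}.
  apply: (ae_orthogonal_eq0 cmu (diKE a)) => // u au.
  apply: filterS2 (sperp u au) (sec_secE au) => p <- <-.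
  have := vP _ _ (sec_in (diKE a) p au).
  by rewrite hdotBl => /eqP; rewrite subr_eq0 => /eqP.
by apply: filterS => p v0 z Ez; rewrite -(vP _ _ Ez) v0 subr0.
Qed.

(** Countably many indices allow one common null set; outside it [sec x p] is orthogonal to a dense
    subspace of [H p]. *)
Lemma countably_cofinal_dense : countably_cofinal L -> closure D = setT.
Proof.
move=> [s cofs]; apply: total_orthogonal_dense.
- exact: locally_hilbert0.
- by move=> a x y; exact: locally_hilbert_lin.
- move=> x xperp; apply: (sec_inj cmu diK) => //.
  have : {ae mu, forall p n z, E (s n) p z -> hdot (sec x p) z = 0}.
    apply/ae_foralln => n; apply: local_orthogonal_fiber => y ay.
    by apply: xperp; exists (s n).
  apply: filterS2 (sec0 diK) => p -> sperp.
  have [[_ incE] dE] := qdE p.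
  apply: (dense_orthogonal_eq0 dE) => z [a _ az].
  by have [n an] := cofs a; apply: (sperp n); exact: incE an _ az.
Qed.

End LocalDiagonal.

(** * Uniqueness of bounded extensions and the embedding *)

Lemma bounded_operator_dense_eq (R : realType) (V : hilbertType R) (D : set V)
    (S T : V -> V) : closure D = setT -> bounded_operator S ->
  bounded_operator T -> (forall x, D x -> S x = T x) -> S = T.
Proof.
move=> dD [lS /bounded_on_sqnormP[c c0 Sc]] [lT /bounded_on_sqnormP[c' c'0 Tc]] ST.
apply/funext => x; apply/eqP; rewrite -subr_eq0 -sqnorm_eq0 eq_le sqnorm_ge0 andbT.
apply/ler_addgt0Pr => e e0; rewrite add0r.
(* Comes from |S w - T w|^2 <= 2 |S w|^2 + 2 |T w|^2; the added 1 keeps [k] positive. *)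
pose k := 2 * c + 2 * c' + 1.
have k0 : 0 < k by rewrite ltr_wpDl// addr_ge0// mulr_ge0.
have /closure_sqnormP/(_ _ (divr_gt0 e0 k0))[y Dy xy] : closure D x by rewrite dD.
have sub U : linear_on setT U -> U (x - y) = U x - U y.
  by move=> lU; rewrite addrC -scaleN1r lU// scaleN1r addrC.
have -> : S x - T x = S (x - y) - T (x - y).
  by rewrite !sub// (ST y)// opprB addrA subrK.
move: (x - y) xy => w; rewrite ltr_pdivlMr// => wk.
apply: le_trans (ltW wk); rewrite sqnormB.
have := Sc w I; have := Tc w I; have := sqnorm_ge0 w.
have := sqnorm_ge0 (S w + T w); rewrite sqnormD /k.
lra.
Qed.

Theorem theorem3p2 (R : realType)
    (* the directed poset and the measure space *)
    (dL : Order.disp_t) (L : porderType dL) (dirL : directed L)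
    (d : measure_display) (X : topMeasurableType d)
    (lcX : locally_compact [set: X]) (scX : sigma_compact X)
    (mu : {measure set X -> \bar R}) (cmu : completed_borel_measure mu)
    (* the quantized domains H_p, with E a p = H_(a,p) *)
    (H : X -> hilbertType R) (sepH : forall p, separable_set [set: H p])
    (E : L -> forall p, set (H p))
    (qdE : forall p, quantized_domain (fun a => E a p))
    (* the direct integral K of the H_p, and KE a of the H_(a,p) *)
    (K : hilbertType R) (sec : K -> forall p, H p)
    (diK : direct_integral mu (fun p => [set: H p]) [set: K] sec)
    (KE : L -> set K) (secE : L -> K -> forall p, H p)
    (diKE : forall a, direct_integral mu (E a) (KE a) (secE a))
    (siKE : strictly_inductive KE)
    (sec_secE : forall a x, KE a x -> {ae mu, forall p, secE a x p = sec x p})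
    (* some H_(a,p) vanishes only where H_p does; vacuous when all the Hilbert
       spaces H_(a,p) are nonzero, or when H_(a,p) = H_p for some a *)
    (supp : exists a, {ae mu, forall p,
        E a p `<=` [set 0] -> [set: H p] `<=` [set 0]}) :
  let D := locally_hilbert KE in
  let DIAG := diagonalizable_op mu E KE sec in
  star_subalgebra D DIAG /\
  exists Phi : (K -> K) -> K -> K,
    [/\ (* Phi T is the unique bounded extension of T that is a
           multiplication operator on K *)
        forall T, DIAG T ->
          unique (fun S => [/\ bounded_operator S, extends D T S
                             & multiplication_on mu sec setT S]) (Phi T),
        (* it is the unique bounded extension when D is dense in K, which
           holds in particular when L has a cofinal sequence *)
        (closure D = setT \/ countably_cofinal L) -> forall T, DIAG T ->
          unique (fun S => bounded_operator S /\ extends D T S) (Phi T),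
        star_homomorphism D DIAG Phi,
        forall S T, DIAG S -> DIAG T -> Phi S = Phi T -> S = T
      & von_neumann_algebra (Phi @` DIAG) /\ abelian_algebra (Phi @` DIAG)].
Proof.
move=> D DIAG; have cmu' := completed_borel_measure_complete cmu.
pose BDIAG := diagonal_bounded mu sec.
(* Off [DIAG] the value of [Phi] is arbitrary. *)
have /choice[Phi PhiP] T : exists S, DIAG T ->
    BDIAG S /\ forall x, D x -> S x = T x.
  have [DT|nDT] := pselect (DIAG T); last by exists T.
  by have [S BS ST] := diagonalizable_extends cmu' qdE diK diKE sec_secE supp DT;
    exists S.
have BPhi T : DIAG T -> BDIAG (Phi T) by move=> /PhiP[].
have PhiE T x : DIAG T -> D x -> Phi T x = T x by move=> /PhiP[_]; apply.
have out T x : DIAG T -> ~ D x -> T x = 0.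
  by move=> [[[T0 _ _] _] _]; exact: T0.
have inD T x : DIAG T -> D x -> D (T x).
  by move=> [[[_ _ lb] _] _] [a _ ax]; exists a => //; have [+ _ _] := lb a; apply.
have D0 : D 0 by exact: locally_hilbert0.
have op0 S : bounded_operator S -> S 0 = 0.
  move=> [_ /bounded_on_sqnormP[c _ /(_ 0 I)]]; rewrite sqnorm0 mulr0 => S0.
  by apply/eqP; rewrite -sqnorm_eq0 eq_le S0 sqnorm_ge0.
(* Every algebraic identity for [Phi] reduces to this: exhibit a multiplication operator that agrees
   on [D]. *)
have PhiU T S : DIAG T -> BDIAG S -> (forall x, D x -> S x = T x) -> Phi T = S.
  move=> DT BS ST.
  apply: (diagonal_bounded_inj cmu' qdE diK diKE sec_secE supp) => //.
    exact: BPhi.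
  by move=> x Dx; rewrite PhiE// ST.
have resB S : BDIAG S -> DIAG (restrict_op KE S).
  exact: (restrict_op_diagonalizable dirL cmu' qdE diK diKE siKE sec_secE).
have restrictP T S : BDIAG S -> (forall x, D x -> T x = S x) ->
    (forall x, ~ D x -> T x = 0) -> DIAG T.
  move=> BS TS T0; rewrite (_ : T = restrict_op KE S); first exact: resB.
  apply/funext => x; have [Dx|nDx] := pselect (D x).
    by rewrite restrict_opE// TS.
  by rewrite restrict_op_out// T0.
have DIAG_lin a S T : DIAG S -> DIAG T -> DIAG (fun x => a *: S x + T x).
  move=> DS DT; apply: (restrictP _ (fun x => a *: Phi S x + Phi T x)).
  - exact: (diagonal_bounded_lin cmu' diK) (BPhi _ DS) (BPhi _ DT).
  - by move=> x Dx; rewrite !PhiE.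
  - by move=> x nDx; rewrite (out S)// (out T)// scaler0 addr0.
have DIAG_comp S T : DIAG S -> DIAG T -> DIAG (S \o T).
  move=> DS DT; apply: (restrictP _ (Phi S \o Phi T)).
  - exact: (diagonal_bounded_comp cmu' diK) (BPhi _ DS) (BPhi _ DT).
  - by move=> x Dx /=; rewrite [Phi T x]PhiE// PhiE//; exact: inD.
  - move=> x nDx /=; rewrite (out T)// -(PhiE S)// op0//.
    by have [] := BPhi _ DS.
have range_Phi : Phi @` DIAG = BDIAG.
  apply/seteqP; split=> [_ [T DT <-]|S BS]; first exact: BPhi.
  exists (restrict_op KE S); first exact: resB.
  by apply: PhiU => //; [exact: resB|move=> x Dx; rewrite restrict_opE].
have ext T : DIAG T -> extends D T (Phi T) by move=> DT x; exact: PhiE.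
split.
  split=> //.
  - by apply: (restrictP _ (fun=> 0)) => //; exact: (diagonal_bounded0 diK).
  - move=> T DT.
    have [S BS PS] := diagonal_bounded_adjoint cmu' diK (BPhi _ DT).
    exists (restrict_op KE S); first exact: resB.
    by move=> x y Dx Dy; rewrite restrict_opE// -(PhiE T)// PS.
exists Phi; split.
- move=> T DT; have [bP mP] := BPhi _ DT; split; first by split=> //; exact: ext.
  by move=> S [bS eS mS]; exact: PhiU.
- move=> dense T DT; have [bP mP] := BPhi _ DT.
  split; first by split=> //; exact: ext.
  move=> S [bS eS].
  apply: (bounded_operator_dense_eq (D := D)) => //.
    case: dense => // cof.
    exact: (countably_cofinal_dense dirL cmu' qdE diK diKE siKE sec_secE).
  by move=> x Dx; rewrite PhiE// eS.
- split.
  + move=> a S T DS DT; apply: PhiU; first exact: DIAG_lin.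
      exact: (diagonal_bounded_lin cmu' diK) (BPhi _ DS) (BPhi _ DT).
    by move=> x Dx; rewrite !PhiE.
  + move=> S T DS DT; apply: PhiU; first exact: DIAG_comp.
      exact: (diagonal_bounded_comp cmu' diK) (BPhi _ DS) (BPhi _ DT).
    by move=> x Dx /=; rewrite [Phi T x]PhiE// PhiE//; exact: inD.
  + move=> S T DS DT TS.
    (* It suffices that the adjoint [S'] of [Phi T] agrees with [S] on [D]. Both map [KE a] into
       itself, so their difference there is tested against [KE a] only, where [S] is adjoint to
       [T]. *)
    have [S' BS' PS'] := diagonal_bounded_adjoint cmu' diK (BPhi _ DT).
    rewrite (PhiU S S')// => y [a _ ay].
    have Dy : D y by exists a.
    have S'y : KE a (S' y).
      have /diagonal_boundedP[_ [f mf fS']] := BS'.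
      exact: (multiplies_stable cmu' qdE diK diKE sec_secE mf fS').
    have Sy : KE a (S y).
      by have [[[_ _ lb] _] _] := DS; have [+ _ _] := lb a; apply.
    apply/eqP; rewrite -subr_eq0; apply/eqP.
    apply: (hdot_self_eq0 (di_sub (diKE a) S'y Sy)).
    move=> z az; have Dz : D z by exists a.
    apply/eqP; rewrite hdotBl subr_eq0; apply/eqP.
    by rewrite hdotC -PS'// PhiE// (TS z y)// -hdotC.
- move=> S T DS DT PST; apply/funext => x.
  have [Dx|nDx] := pselect (D x); last by rewrite !out.
  by rewrite -PhiE// PST PhiE.
- rewrite range_Phi; split; last first.
    by move=> S T; exact: (diagonal_bounded_commute cmu' diK).
  split.
  + by move=> S [].
  + exact: diagonal_bounded_star_subalgebra.
  + exact: (diagonal_bounded_id mu sec).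
  + move=> S bS wS; apply: (wot_adherent_diagonal_bounded cmu' diK) => //.
    by case: diK => -[].
Qed.
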